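(* Let $K\subset\mathbb R^5$ be a convex body. Then \[ \frac{R_3(K)}{r_3(K)} < 3.518. \]
   Context: A convex body in $\mathbb R^n$ is a compact convex subset of $\mathbb R^n$ with non-empty interior. All notions are with respect to the Euclidean norm. For $1\le j\le n$, the $j$-th successive outer radius of $K$ is $R_j(K)=\min\{R(P_L(K)) : L \text{ a } j\text{-dimensional affine subspace of } \mathbb R^n\}$, where $P_L(K)$ is the orthogonal projection of $K$ onto $L$ and $R(\cdot)$ is the circumradius, i.e. the smallest radius of a Euclidean ball containing the set. The $j$-th successive inner radius of $K$ is $r_j(K)=\max\{r_L(K\cap L): L \text{ a } j\text{-dimensional affine subspace of } \mathbb R^n \text{ with } K\cap L\neq\emptyset\}$, where $r_L(C)$ is the inradius of $C\subset L$ measured within $L$, i.e. the largest $\rho\ge 0$ such that $C$ contains a $j$-dimensional Euclidean ball of $L$ of radius $\rho$. *)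

(* Defs.v *)
From HB Require Import structures.
From mathcomp Require Import all_boot all_order all_algebra.
From mathcomp Require Import all_classical all_reals all_analysis.

Set Implicit Arguments.
Unset Strict Implicit.
Unset Printing Implicit Defensive.

Import Order.TTheory GRing.Theory Num.Theory.
Import numFieldNormedType.Exports.

Local Open Scope classical_set_scope.
Local Open Scope ring_scope.

(* The library norm on row vectors is the sup norm, so the Euclidean norm is
   defined here; both induce the topology used for [compact] and interior. *)
Definition dotv (R : realType) (n : nat) (u v : 'rV[R]_n) : R :=
  \sum_(i < n) u 0 i * v 0 i.

Definition enorm (R : realType) (n : nat) (u : 'rV[R]_n) : R :=
  Num.sqrt (dotv u u).

Definition ecball (R : realType) (n : nat) (c : 'rV[R]_n) (r : R) :
  set 'rV[R]_n := [set x | enorm (x - c) <= r].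

Definition convex_body (R : realType) (n : nat) (K : set 'rV[R]_n) : Prop :=
  [/\ compact K, convex_set K & K° !=set0].

Definition affine_subspace (R : realType) (n j : nat) (L : set 'rV[R]_n) :
  Prop :=
  exists (p : 'rV[R]_n) (V : {vspace 'rV[R]_n}),
    \dim V = j /\ L = [set x | x - p \in V].

(* [is_eproj L x y]: y is the orthogonal projection of the point x onto the
   affine subspace L; the differences z - y, z in L, form the direction of L. *)
Definition is_eproj (R : realType) (n : nat) (L : set 'rV[R]_n)
  (x y : 'rV[R]_n) : Prop :=
  L y /\ forall z, L z -> dotv (x - y) (z - y) = 0.

Definition eproj_set (R : realType) (n : nat) (L K : set 'rV[R]_n) :
  set 'rV[R]_n := [set y | exists2 x, K x & is_eproj L x y].

(* The extrema below are attained whenever K is a convex body and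
   1 <= j <= n, so that [inf] is a minimum and [sup] a maximum. *)
Definition circumradius (R : realType) (n : nat) (A : set 'rV[R]_n) : R :=
  inf [set r | 0 <= r /\ exists c, A `<=` ecball c r].

Definition inradius_in (R : realType) (n : nat) (L C : set 'rV[R]_n) : R :=
  sup [set r | 0 <= r /\ exists2 c, L c & ecball c r `&` L `<=` C].

Definition outer_radius (R : realType) (n j : nat) (K : set 'rV[R]_n) : R :=
  inf [set circumradius (eproj_set L K) |
       L in [set L | affine_subspace j L]].

Definition inner_radius (R : realType) (n j : nat) (K : set 'rV[R]_n) : R :=
  sup [set inradius_in L (K `&` L) |
       L in [set L | affine_subspace j L /\ K `&` L !=set0]].

(* Main.v *)
(* Let D = R_3(K) and suppose r_3(K) < D/c with c = 197/56 < 3.518.  By duality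
   (weights proportional to the norms), if linear functionals g_k sum to zero on
   a 3-space V and \sum_k g_k(v) x_k = v there for points x_k of K, then
   \sum_k |g_k| > c/D; every case below ends by violating this bound.

   Project K to a 3-space and look at the contact points of the minimal ball of
   the projection.  If they form a nearly regular tetrahedron, its barycentric
   coordinates violate the bound; otherwise either two of them are far apart, or
   three of them form a nearly regular triangle of large circumradius.  Call
   (x - x')/2, with x, x' in K, a half-chord, and take half-chords z_1, z_2, z_3
   spanning a parallelepiped of maximal volume.  If all its squared heights are at
   least 8/11 D^2, the octahedron on the three chords violates the bound.  If the
   height over z_2, z_3 is smaller, then by maximality all half-chords project
   short along span(z_2, z_3), so the projection along that plane yields a
   triangle; the same maximality bounds the extent of K across z_3, and the
   triangle together with the chord of z_2 violates the bound. *)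
Require Import Defs.
From mathcomp Require Import all_boot all_order all_algebra.
From mathcomp Require Import all_classical all_reals all_analysis.
From mathcomp Require Import ring lra.
Set Implicit Arguments.
Unset Strict Implicit.
Unset Printing Implicit Defensive.
Import Order.TTheory GRing.Theory Num.Theory.
Import numFieldNormedType.Exports.
Local Open Scope classical_set_scope.
Local Open Scope ring_scope.

(** * The Euclidean inner product and orthonormal frames *)

Section Dotv.
Variables (R : realType) (n : nat).
Implicit Types u v w : 'rV[R]_n.

Lemma dotvE u v : dotv u v = (u *m v^T) 0 0.
Proof. by rewrite mxE; apply: eq_bigr => i _; rewrite mxE. Qed.

Lemma dotvC u v : dotv u v = dotv v u.
Proof. by apply: eq_bigr => i _; rewrite mulrC. Qed.

Lemma dotvDl u v w : dotv (u + v) w = dotv u w + dotv v w.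
Proof. by rewrite !dotvE mulmxDl mxE. Qed.

Lemma dotvNl u v : dotv (- u) v = - dotv u v.
Proof. by rewrite !dotvE mulNmx mxE. Qed.

Lemma dotvZl a u v : dotv (a *: u) v = a * dotv u v.
Proof. by rewrite !dotvE -scalemxAl mxE. Qed.

Lemma dotvDr u v w : dotv w (u + v) = dotv w u + dotv w v.
Proof. by rewrite dotvC dotvDl !(dotvC w). Qed.

Lemma dotvNr u v : dotv v (- u) = - dotv v u.
Proof. by rewrite dotvC dotvNl dotvC. Qed.

Lemma dotvZr a u v : dotv v (a *: u) = a * dotv v u.
Proof. by rewrite dotvC dotvZl dotvC. Qed.

Lemma dotv0l u : dotv 0 u = 0.
Proof. by rewrite dotvE mul0mx mxE. Qed.

Lemma dotv0r u : dotv u 0 = 0.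
Proof. by rewrite dotvC dotv0l. Qed.

Definition dotv_lin := (dotvDl, dotvDr, dotvNl, dotvNr, dotvZl, dotvZr).

Lemma dotv_suml (I : finType) (F : I -> 'rV[R]_n) v :
  dotv (\sum_i F i) v = \sum_i dotv (F i) v.
Proof.
apply: (big_morph (fun u => dotv u v)); first by move=> x y; rewrite dotvDl.
by rewrite dotv0l.
Qed.

Lemma dotv_sumr (I : finType) (F : I -> 'rV[R]_n) v :
  dotv v (\sum_i F i) = \sum_i dotv v (F i).
Proof. by rewrite dotvC dotv_suml; apply: eq_bigr => i _; rewrite dotvC. Qed.

Lemma dotv_ge0 u : 0 <= dotv u u.
Proof. by apply: sumr_ge0 => i _; rewrite -expr2 sqr_ge0. Qed.

Lemma dotv_eq0 u : (dotv u u == 0) = (u == 0).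
Proof.
apply/eqP/eqP => [|->]; last by rewrite dotv0l.
move=> /eqP; rewrite psumr_eq0; last by move=> i _; rewrite -expr2 sqr_ge0.
move=> /allP h; apply/rowP => i; rewrite mxE.
have /implyP := h i (mem_index_enum i).
by move=> /(_ isT); rewrite mulf_eq0 => /orP[] /eqP.
Qed.

Lemma dotv_gt0 u : u != 0 -> 0 < dotv u u.
Proof. by move=> u0; rewrite lt0r dotv_eq0 u0 dotv_ge0. Qed.

Lemma dotv_CS u v : dotv u v ^+ 2 <= dotv u u * dotv v v.
Proof.
have [->|v0] := eqVneq v 0; first by rewrite !dotv0r expr0n mulr0.
have vv := dotv_gt0 v0.
have := dotv_ge0 (dotv v v *: u - dotv u v *: v).
rewrite !dotv_lin (dotvC v u) => h.
rewrite -subr_ge0 -(pmulr_rge0 _ vv); apply: le_trans h _.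
by rewrite le_eqVlt; apply/orP; left; apply/eqP; ring.
Qed.

Lemma enorm_ge0 u : 0 <= enorm u.
Proof. exact: sqrtr_ge0. Qed.

Lemma enorm_sqr u : enorm u ^+ 2 = dotv u u.
Proof. by rewrite sqr_sqrtr// dotv_ge0. Qed.

Lemma enorm_le u a : 0 <= a -> (enorm u <= a) = (dotv u u <= a ^+ 2).
Proof.
by move=> a0; rewrite -enorm_sqr ler_pXn2r// nnegrE enorm_ge0.
Qed.

Lemma enormN u : enorm (- u) = enorm u.
Proof. by rewrite /enorm !dotv_lin opprK. Qed.

Lemma enormZ a u : enorm (a *: u) = `|a| * enorm u.
Proof.
by rewrite /enorm !dotv_lin mulrA -expr2 sqrtrM ?sqr_ge0// sqrtr_sqr.
Qed.

Lemma dotv_le_enorm u v : `|dotv u v| <= enorm u * enorm v.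
Proof.
have h : 0 <= enorm u * enorm v by rewrite mulr_ge0// enorm_ge0.
rewrite -(ler_pXn2r (_ : 0 < 2)%N) ?nnegrE//.
by rewrite exprMn !enorm_sqr real_normK ?num_real// dotv_CS.
Qed.

Lemma enormD u v : enorm (u + v) <= enorm u + enorm v.
Proof.
rewrite enorm_le ?addr_ge0 ?enorm_ge0// !dotv_lin (dotvC v u) sqrrD !enorm_sqr.
have := le_trans (ler_norm _) (dotv_le_enorm u v); lra.
Qed.

End Dotv.

(** [B] has fewer rows than columns, so [kermx B^T] has a nonzero row; normalising it gives [v]. *)
Lemma exists_unit_orthogonal (R : realType) (m n : nat) (B : 'M[R]_(m, n)) :
  (m < n)%N ->
  exists v : 'rV[R]_n, dotv v v = 1 /\ forall i, dotv v (row i B) = 0.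
Proof.
move=> mn; have : (\rank (kermx B^T) > 0)%N.
  by rewrite mxrank_ker subn_gt0 (leq_ltn_trans (rank_leq_col _))//.
rewrite lt0n mxrank_eq0 => k0.
have [i ki] : exists i, row i (kermx B^T) != 0.
  apply/not_existsP => h; move/eqP: k0; apply; apply/row_matrixP => i.
  by have /negP := h i; rewrite negbK row0 => /eqP.
set w := row i (kermx B^T) in ki.
have wB : w *m B^T = 0 by rewrite -row_mul mulmx_ker row0.
have ww := dotv_gt0 ki.
exists ((enorm w)^-1 *: w); split.
  by rewrite !dotv_lin -enorm_sqr; field; rewrite gt_eqF// sqrtr_gt0.
move=> j; rewrite dotvZl dotvE.
have /matrixP/(_ 0 j) := wB; rewrite !mxE => h.
rewrite (_ : \sum_j0 _ = 0) ?mulr0// -[RHS]h.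
by apply: eq_bigr => l _; rewrite !mxE.
Qed.

Section Frames.
Variables (R : realType) (m n : nat) (E : 'M[R]_(m, n)).
(** The rows of [E] are orthonormal: [x *m E^T] lists the coordinates of the projection of [x] onto
    their span, and [u *m E] is the point with coordinates [u]. *)
Hypothesis EE : E *m E^T = 1%:M.

Lemma dotv_mulmx_tr (x : 'rV[R]_n) (u : 'rV[R]_m) :
  dotv (x *m E^T) u = dotv x (u *m E).
Proof. by rewrite !dotvE trmx_mul mulmxA. Qed.

Lemma dotv_frame (u v : 'rV[R]_m) : dotv (u *m E) (v *m E) = dotv u v.
Proof. by rewrite -dotv_mulmx_tr -mulmxA EE mulmx1. Qed.

Lemma enorm_frame (u : 'rV[R]_m) : enorm (u *m E) = enorm u.
Proof. by rewrite /enorm dotv_frame. Qed.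

Lemma frame_orth (y : 'rV[R]_n) :
  (forall i, dotv (row i E) y = 0) -> y *m E^T = 0.
Proof.
move=> h; apply/rowP => i; rewrite [RHS]mxE -[RHS](h i) mxE dotvE !mxE.
by apply: eq_bigr => j _; rewrite !mxE mulrC.
Qed.

Lemma bessel (x : 'rV[R]_n) : dotv (x *m E^T) (x *m E^T) <= dotv x x.
Proof.
have := dotv_ge0 (x - x *m E^T *m E).
rewrite !dotv_lin dotv_frame (dotvC _ x) -dotv_mulmx_tr; lra.
Qed.

(** Bessel for [x] minus its component along [u], which has the same coordinates as [x] because [u]
    is orthogonal to the frame. *)
Lemma bessel_unit (u x : 'rV[R]_n) : dotv u u = 1 -> u *m E^T = 0 ->
  dotv (x *m E^T) (x *m E^T) + dotv x u ^+ 2 <= dotv x x.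
Proof.
move=> uu uE; have := bessel (x - dotv x u *: u).
rewrite mulmxBl -scalemxAl uE scaler0 subr0 !dotv_lin uu (dotvC u x).
nra.
Qed.

End Frames.

(** Unit vectors are chosen one after another, orthogonal to [a], [b] and those found before. Such
    frames project along the plane of two chords. *)
Lemma exists_frame (R : realType) (a b : 'rV[R]_5) :
  exists E : 'M[R]_(3, 5),
    [/\ E *m E^T = 1%:M, a *m E^T = 0 & b *m E^T = 0].
Proof.
have [e1 [e11 h1]] := exists_unit_orthogonal (col_mx a b) (isT : (2 < 5)%N).
have [e2 [e22 h2]] :=
  exists_unit_orthogonal (col_mx e1 (col_mx a b)) (isT : (3 < 5)%N).
have [e3 [e33 h3]] :=
  exists_unit_orthogonal (col_mx e2 (col_mx e1 (col_mx a b))) (isT : (4 < 5)%N).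
have rU (p q : nat) (A : 'M[R]_(p, 5)) (B : 'M[R]_(q, 5)) v :
  (forall i, dotv v (row i (col_mx A B)) = 0) ->
  (forall i, dotv v (row i A) = 0) /\ (forall i, dotv v (row i B) = 0).
  move=> h; split=> i.
  - by rewrite -(h (lshift _ i)) rowKu.
  - by rewrite -(h (rshift _ i)) rowKd.
have [a1 b1] := rU _ _ _ _ _ h1.
have [c2 /rU[a2 b2]] := rU _ _ _ _ _ h2.
have [d3 /rU[c3 /rU[a3 b3]]] := rU _ _ _ _ _ h3.
move: (a1 0) (b1 0) (a2 0) (b2 0) (c2 0) (a3 0) (b3 0) (c3 0) (d3 0).
rewrite !row_id => {a1 b1 a2 b2 c2 a3 b3 c3 d3 h1 h2 h3 rU}.
move=> a1 b1 a2 b2 c2 a3 b3 c3 d3.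
pose f (i : 'I_3) := nth 0 [:: e1; e2; e3] i.
pose E := \matrix_(i < 3) f i.
have rE i : row i E = f i by rewrite rowK.
exists E; split.
- apply/matrixP => i j.
  have -> : (E *m E^T) i j = dotv (f i) (f j).
    by rewrite -!rE mxE; apply: eq_bigr => l _; rewrite !mxE.
  rewrite mxE /f; move: i j.
  by do 2! [case=> [[|[|[|]]]//= ?]];
    rewrite ?e11 ?e22 ?e33 ?c2 ?c3 ?d3// dotvC ?c2 ?c3 ?d3.
- apply: frame_orth => i; rewrite rE /f.
  by case: i => [[|[|[|]]]//= ?]; rewrite ?a1 ?a2 ?a3.
- apply: frame_orth => i; rewrite rE /f.
  by case: i => [[|[|[|]]]//= ?]; rewrite ?b1 ?b2 ?b3.
Qed.

(** * Gram determinants *)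

Section Gram.
Variables (R : realType) (n : nat).
Implicit Types a b z : 'rV[R]_n.

(** Squared area of the parallelogram on [a] and [b]; [gram3] is the squared volume of the
    parallelepiped. *)
Definition gram2 a b : R := dotv a a * dotv b b - dotv a b ^+ 2.

Definition gram3 z a b : R :=
  dotv z z * gram2 a b + 2 * dotv a b * dotv z a * dotv z b
  - dotv a a * dotv z b ^+ 2 - dotv b b * dotv z a ^+ 2.

(* [gram2 a b] times the component of [z] orthogonal to [a] and [b]. *)
Definition normal3 z a b : 'rV[R]_n :=
  gram2 a b *: z - (dotv z a * dotv b b - dotv z b * dotv a b) *: a
  - (dotv z b * dotv a a - dotv z a * dotv a b) *: b.

Lemma normal3_fst z a b : dotv (normal3 z a b) z = gram3 z a b.
Proof.
by rewrite /normal3 !dotv_lin (dotvC a z) (dotvC b z) /gram3 /gram2; ring.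
Qed.

Lemma normal3_snd z a b : dotv (normal3 z a b) a = 0.
Proof. by rewrite /normal3 !dotv_lin (dotvC b a) /gram2; ring. Qed.

Lemma normal3_thd z a b : dotv (normal3 z a b) b = 0.
Proof. by rewrite /normal3 !dotv_lin /gram2; ring. Qed.

Lemma normal3_sqr z a b :
  dotv (normal3 z a b) (normal3 z a b) = gram2 a b * gram3 z a b.
Proof.
rewrite {2}/normal3 !(dotvDr, dotvNr, dotvZr).
by rewrite normal3_fst normal3_snd normal3_thd; ring.
Qed.

Lemma gram3_rot z a b : gram3 z a b = gram3 a b z.
Proof.
by rewrite /gram3 /gram2 (dotvC b z) (dotvC a z); ring.
Qed.

Lemma gram2C a b : gram2 a b = gram2 b a.
Proof. by rewrite /gram2 (dotvC b a); ring. Qed.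

Lemma gram2_ge0 a b : 0 <= gram2 a b.
Proof. by rewrite subr_ge0 dotv_CS. Qed.

(** [gram3 z a b / gram2 a b] is the squared height of [z] over the plane of [a] and [b], which
    bounds its projection to a frame orthogonal to that plane. Bessel is applied to [normal3 z a b],
    whose coordinates are [gram2 a b] times those of [z]. *)
Lemma gram3_frame m (E : 'M[R]_(m, n)) z a b : E *m E^T = 1%:M ->
  a *m E^T = 0 -> b *m E^T = 0 -> 0 < gram2 a b ->
  dotv (z *m E^T) (z *m E^T) * gram2 a b <= gram3 z a b.
Proof.
move=> EE aE bE g0; have := bessel EE (normal3 z a b).
rewrite normal3_sqr /normal3 !mulmxBl -!scalemxAl aE bE !scaler0 !subr0.
rewrite !dotv_lin => h.
rewrite -(ler_pM2l g0); apply: le_trans h.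
by rewrite le_eqVlt; apply/orP; left; apply/eqP; ring.
Qed.

End Gram.

(** * Bounds on the radii *)

Section Continuity.
Variables (R : realType) (X : topologicalType).

Lemma continuous_sum (V : normedModType R) (I : Type) (r : seq I)
    (F : I -> X -> V) :
  (forall i, continuous (F i)) -> continuous (fun x => \sum_(i <- r) F i x).
Proof.
move=> cF x; elim: r => [|i r ih].
  by under eq_fun do rewrite big_nil; exact: cvg_cst.
by under eq_fun do rewrite big_cons; apply: cvgD; [exact: cF|exact: ih].
Qed.

Lemma continuous_dotv n (f g : X -> 'rV[R]_n) :
  continuous f -> continuous g -> continuous (fun x => dotv (f x) (g x)).
Proof.
move=> cf cg; apply: continuous_sum => i x; apply: cvgM.
- by apply: (@continuous_comp _ _ _ f (fun v => v 0 i));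
    [exact: cf|exact: coord_continuous].
- by apply: (@continuous_comp _ _ _ g (fun v => v 0 i));
    [exact: cg|exact: coord_continuous].
Qed.

Lemma continuous_mul (f g : X -> R) :
  continuous f -> continuous g -> continuous (fun x => f x * g x).
Proof. by move=> cf cg x; apply: cvgM; [exact: cf|exact: cg]. Qed.

Lemma continuous_scale (V : normedModType R) (f : X -> R) (g : X -> V) :
  continuous f -> continuous g -> continuous (fun x => f x *: g x).
Proof. by move=> cf cg x; apply: cvgZ; [exact: cf|exact: cg]. Qed.

Lemma continuous_sub (f g : X -> R) :
  continuous f -> continuous g -> continuous (fun x => f x - g x).
Proof. by move=> cf cg x; apply: cvgB; [exact: cf|exact: cg]. Qed.

End Continuity.

Lemma compact_enorm_bounded (R : realType) n (K : set 'rV[R]_n) :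
  compact K -> exists2 B : R, 0 <= B & forall x, K x -> enorm x <= B.
Proof.
move=> cK; have [K0|/set0P/negP] := pselect (K !=set0); last first.
  by rewrite negbK => /eqP ->; exists 0.
have ct : continuous (fun x : 'rV[R]_n => dotv x x).
  by apply: continuous_dotv => x; exact: cvg_id.
have [c _ hc] := compact_EVT_max K0 cK (continuous_subspaceT ct).
exists (enorm c) => [|x Kx]; first exact: enorm_ge0.
by rewrite enorm_le ?enorm_ge0// enorm_sqr hc// inE.
Qed.

(** * Convex combinations *)

Section Convexity.
Variables (R : realType) (n : nat) (K : set 'rV[R]_n).
Hypothesis cK : convex_set K.

Lemma convex_set_conv (x y : 'rV[R]_n) (t : R) : K x -> K y -> 0 <= t <= 1 ->
  K (t *: x + (1 - t) *: y).
Proof.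
move=> Kx Ky /andP[t0 t1].
have := @cK x y (Itv01 t0 t1); rewrite !inE => /(_ Kx Ky).
by rewrite /conv/=.
Qed.

Lemma convex_set_sum m (a : 'I_m -> R) (x : 'I_m -> 'rV[R]_n) :
  (forall i, 0 <= a i) -> \sum_i a i = 1 -> (forall i, K (x i)) ->
  K (\sum_i a i *: x i).
Proof.
elim: m a x => [|m ih] a x a0 s1 Kx.
  by move: s1; rewrite big_ord0 => /esym/eqP; rewrite oner_eq0.
move: s1; rewrite !big_ord_recl => s1.
have s0 : 0 <= \sum_(i < m) a (lift ord0 i) by apply: sumr_ge0.
have [e|ne] := eqVneq (\sum_(i < m) a (lift ord0 i)) 0.
  have az i : a (lift ord0 i) = 0.
    move/eqP: e; rewrite psumr_eq0// => /allP/(_ i (mem_index_enum i)).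
    by move/eqP.
  rewrite big1 ?addr0; last by move=> i _; rewrite az scale0r.
  by move: s1; rewrite e addr0 => ->; rewrite scale1r.
(* The remaining weights sum to [1 - a ord0], nonzero here; divided by it they form a convex
   combination covered by induction. *)
have -> : \sum_(i < m) a (lift ord0 i) *: x (lift ord0 i) =
   (1 - a ord0) *: (\sum_(i < m) (a (lift ord0 i) / (1 - a ord0)) *:
      x (lift ord0 i)).
  rewrite scaler_sumr; apply: eq_bigr => i _.
  rewrite scalerA mulrCA mulfV ?mulr1//.
  by rewrite -s1 addrAC subrr add0r.
apply: convex_set_conv => //; last by rewrite a0 -s1 lerDl.
apply: ih => //; first by move=> i; rewrite divr_ge0// -s1 addrAC subrr add0r.
by rewrite -mulr_suml -s1 addrAC subrr add0r mulfV.
Qed.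

Lemma convex_set_sum_fin (I : finType) (a : I -> R) (x : I -> 'rV[R]_n) :
  (forall i, 0 <= a i) -> \sum_i a i = 1 -> (forall i, K (x i)) ->
  K (\sum_i a i *: x i).
Proof.
move=> a0 a1 Kx.
have re (W : nmodType) (F : I -> W) :
    \sum_i F i = \sum_(j < #|I|) F (enum_val j).
  by rewrite (reindex (fun j : 'I_#|I| => enum_val j))//;
     exists enum_rank => ? _; [exact: enum_valK|exact: enum_rankK].
by rewrite re; apply: convex_set_sum => //; rewrite -re.
Qed.

End Convexity.

(** * Bounds on the radii from frames and functionals *)

Section Radii.
Variables (R : realType) (K : set 'rV[R]_5).

Definition frame_space (E : 'M[R]_(3, 5)) : {vspace 'rV[R]_5} :=
  <<[seq row i E | i <- enum 'I_3]>>%VS.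

(** Pairing a linear relation with [h i] isolates the coefficient of [b i], so a dual family
    certifies independence. *)
Lemma free_dual n k (h b : 'I_k -> 'rV[R]_n) :
  (forall i j, dotv (h i) (b j) = (i == j)%:R) ->
  free [seq b i | i <- enum 'I_k].
Proof.
move=> hb; set s := map _ _.
have ss : size s == k by rewrite size_map size_enum_ord.
apply/(@freeP _ _ _ (Tuple ss)) => c c0 i.
have := congr1 (dotv (h i)) c0; rewrite dotv0r dotv_sumr (bigD1 i)//= big1.
  rewrite addr0 (nth_map i) ?size_enum_ord// nth_ord_enum dotvZr hb eqxx.
  by rewrite mulr1.
move=> j ji; rewrite (nth_map i) ?size_enum_ord// nth_ord_enum dotvZr hb.
by rewrite eq_sym (negbTE ji) mulr0.
Qed.

Lemma frame_dotv_row (E : 'M[R]_(3, 5)) : E *m E^T = 1%:M ->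
  forall i j, dotv (row i E) (row j E) = (i == j)%:R.
Proof.
move=> EE i j; have /matrixP/(_ i j) := EE; rewrite !mxE => <-.
by apply: eq_bigr => l _; rewrite !mxE.
Qed.

Lemma dim_frame_space (E : 'M[R]_(3, 5)) : E *m E^T = 1%:M ->
  \dim (frame_space E) = 3.
Proof.
move=> EE; have := free_dual (frame_dotv_row EE).
by rewrite /free size_map size_enum_ord => /eqP.
Qed.

Lemma mulmx_frame_space (E : 'M[R]_(3, 5)) (u : 'rV[R]_3) :
  u *m E \in frame_space E.
Proof.
rewrite mulmx_sum_row memv_suml// => i _; rewrite memvZ// memv_span//.
by apply/mapP; exists i; rewrite ?mem_enum.
Qed.

Lemma outer_radius_le_frame (E : 'M[R]_(3, 5)) (c : 'rV[R]_3) (rho : R) :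
  E *m E^T = 1%:M -> 0 <= rho ->
  (forall x, K x -> dotv (x *m E^T - c) (x *m E^T - c) <= rho ^+ 2) ->
  outer_radius 3 K <= rho.
Proof.
move=> EE rho0 h.
pose L : set 'rV[R]_5 := [set z | z - 0 \in frame_space E].
(* This also covers an empty set of radii, where [inf] is 0; it supplies the lower bound that
   [ge_inf] asks for. *)
have cr0 (A : set 'rV[R]_5) : 0 <= circumradius A.
  rewrite /circumradius; have [s0|] := pselect
    ([set r : R | 0 <= r /\ exists c, A `<=` ecball c r] !=set0).
    by apply: lb_le_inf => // r [].
  by move/set0P/negP; rewrite negbK => /eqP ->; rewrite inf0.
apply: (@le_trans _ _ (circumradius (eproj_set L K))).
  apply: ge_inf; first by exists 0 => _ [A _ <-]; exact: cr0.
  by exists L => //; exists 0, (frame_space E); rewrite dim_frame_space.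
apply: ge_inf; first by exists 0 => r [].
split=> //; exists (c *m E) => y [x Kx [Ly hy]].
rewrite /ecball/= enorm_le//.
(* [is_eproj] determines the projection: [x *m E^T *m E - y] is orthogonal to itself. *)
have yE : y = x *m E^T *m E.
  apply/eqP; rewrite -subr_eq0 -dotv_eq0.
  have xL : L (x *m E^T *m E) by rewrite /L/= subr0 mulmx_frame_space.
  have xy := hy _ xL.
  have e1 : dotv (x - x *m E^T *m E) (x *m E^T *m E - y) = 0.
    rewrite dotvDr dotvNr.
    have q v : v \in frame_space E -> dotv (x - x *m E^T *m E) v = 0.
      move=> vE; have -> : v = v *m E^T *m E.
        have := free_dual (frame_dotv_row EE).
        move: vE; rewrite /frame_space.
        set s := map _ _ => vE _.
        have ss : size s == 3 by rewrite size_map size_enum_ord.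
        have := @coord_span _ _ _ (Tuple ss) v vE => {1 2}->.
        rewrite !mulmx_suml; apply: eq_bigr => i _.
        rewrite (nth_map i) ?size_enum_ord// nth_ord_enum -!scalemxAl.
        congr (_ *: _); rewrite rowE -!mulmxA.
        by rewrite [E *m (_ *m _)]mulmxA EE mul1mx.
      rewrite -dotv_mulmx_tr mulmxBl -!mulmxA [E *m _ ]EE mulmx1.
      by rewrite subrr dotv0l.
    rewrite !q ?subrr//; last exact: mulmx_frame_space.
    by move: Ly; rewrite /L/= subr0.
  rewrite -opprB dotvNl dotvNr opprK.
  have -> : dotv (x *m E^T *m E - y) (x *m E^T *m E - y) =
      dotv (x - y) (x *m E^T *m E - y)
      - dotv (x - x *m E^T *m E) (x *m E^T *m E - y).
    rewrite -dotvNl -dotvDl; congr (dotv _ _).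
    by rewrite opprB [RHS]addrC addrA subrK.
  by rewrite xy e1 subrr.
have -> : y - c *m E = (x *m E^T - c) *m E by rewrite yE mulmxBl.
by rewrite dotv_frame// h.
Qed.

Lemma inner_radius_ge (t : R) (b h : 'I_3 -> 'rV[R]_5) (c : 'rV[R]_5) :
  compact K -> 0 <= t ->
  (forall i j, dotv (h i) (b j) = (i == j)%:R) ->
  (forall v, v \in <<[seq b i | i <- enum 'I_3]>>%VS -> enorm v <= t ->
     K (c + v)) ->
  t <= inner_radius 3 K.
Proof.
move=> cK t0 hb hK.
have [B B0 hB] := compact_enorm_bounded cK.
(* A ball of radius [r] in [L] contains the two points [c' + v] and [c' - v] at distance [2 r], so
   [B] bounds the radii and the suprema are finite. *)
have inB L : affine_subspace 3 L ->
    ubound [set r | 0 <= r /\ exists2 c, L c & ecball c r `&` L `<=` K `&` L] B.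
  move=> [p [V [dV ->]]] r [r0 [c' Lc hc]].
  have V0 : V != 0%VS by rewrite -dimv_eq0 dV.
  pose w := vpick V; have w0 : w != 0 by rewrite vpick0.
  have ew : 0 < enorm w by rewrite sqrtr_gt0 dotv_gt0.
  pose v := (r / enorm w) *: w.
  have ev : enorm v = r.
    by rewrite enormZ ger0_norm ?divfK ?gt_eqF// divr_ge0// ltW.
  have vV : v \in V by rewrite memvZ// memv_pick.
  have [K1 _] : (K `&` [set x | x - p \in V]) (c' + v).
    apply: hc; split; rewrite /ecball/=.
      by rewrite addrAC subrr add0r ev.
    by rewrite addrAC memvD.
  have [K2 _] : (K `&` [set x | x - p \in V]) (c' - v).
    apply: hc; split; rewrite /ecball/=.
      by rewrite addrAC subrr add0r enormN ev.
    by rewrite addrAC memvB.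
  have := enormD (c' + v) (- (c' - v)); rewrite enormN.
  have -> : c' + v - (c' - v) = 2 *: v.
    by rewrite opprB -[LHS]addrA (addrA v) [LHS]addrC subrK scaler_nat mulr2n.
  rewrite enormZ ev ger0_norm//.
  have := hB _ K1; have := hB _ K2; lra.
pose V := <<[seq b i | i <- enum 'I_3]>>%VS.
pose L : set 'rV[R]_5 := [set x | x - c \in V].
have dV : \dim V = 3.
  by have := free_dual hb; rewrite /free size_map size_enum_ord => /eqP.
have aL : affine_subspace 3 L by exists c, V.
have Lc : L c by rewrite /L/= subrr mem0v.
have Kc : K c.
  by rewrite -[c]addr0; apply: hK; rewrite ?mem0v// /enorm dotv0l sqrtr0.
have tl : [set r | 0 <= r /\ exists2 c, L c & ecball c r `&` L `<=` K `&` L] t.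
  split=> //; exists c => // x [xb xL]; split=> //.
  by rewrite -[x](subrK c) addrC; apply: hK.
apply: (@le_trans _ _ (inradius_in L (K `&` L))).
  by apply: ub_le_sup => //; exists B; exact: inB.
apply: ub_le_sup; last by exists L => //; split=> //; exists c.
exists B => _ [L' [aL' [x [Kx Lx]]] <-].
(* The ball of radius 0 at [x] keeps the set nonempty, as bounding its supremum requires. *)
have s0 : [set r : R | 0 <= r /\
    exists2 c, L' c & ecball c r `&` L' `<=` K `&` L'] 0.
  split=> //; exists x => // y [yb Ly]; split=> //.
  suff -> : y = x by [].
  apply/eqP; rewrite -subr_eq0 -dotv_eq0 eq_le dotv_ge0 andbT.
  by move: yb; rewrite /ecball/= enorm_le// expr0n.
by apply: ge_sup; [exists 0|exact: inB].
Qed.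

(** The centre is the mean of the [x k] with weights [enorm (g k) / T]. Adding [v] changes the
    weights by [dotv (g k) v]: they still sum to 1, and stay nonnegative by Cauchy-Schwarz while
    [enorm v <= T^-1]. *)
Lemma inner_radius_ge_functionals (I : finType) (x g : I -> 'rV[R]_5)
    (b h : 'I_3 -> 'rV[R]_5) (S : R) :
  compact K -> convex_set K -> (forall k, K (x k)) ->
  (forall i j, dotv (h i) (b j) = (i == j)%:R) ->
  (forall j, \sum_k dotv (g k) (b j) = 0) ->
  (forall j, \sum_k dotv (g k) (b j) *: x k = b j) ->
  \sum_k enorm (g k) <= S ->
  S^-1 <= inner_radius 3 K.
Proof.
move=> cK vK Kx hb g0 gx gS.
pose T := \sum_k enorm (g k).
have T0 : 0 <= T by apply: sumr_ge0 => k _; exact: enorm_ge0.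
(* If all [g k] vanished, [gx] would give [b ord0 = 0], against [hb]. *)
have Tn : T != 0.
  apply/eqP => Tz.
  have gz k : g k = 0.
    move/eqP: Tz; rewrite psumr_eq0; last by move=> i _; exact: enorm_ge0.
    move=> /allP/(_ k (mem_index_enum k)) /= /eqP e.
    by apply/eqP; rewrite -dotv_eq0 -enorm_sqr e expr0n.
  have := hb ord0 ord0; rewrite -(gx ord0) big1 ?dotv0r; last first.
    by move=> k _; rewrite gz dotv0l scale0r.
  by move=> /esym/eqP; rewrite oner_eq0.
have Tp : 0 < T by rewrite lt0r Tn.
apply: (@le_trans _ _ T^-1); first by rewrite lef_pV2// posrE (lt_le_trans Tp).
apply: (@inner_radius_ge _ b h (\sum_k (enorm (g k) / T) *: x k)) => //.
  by rewrite invr_ge0.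
move=> v vV ev.
(* Both identities pass from the [b j] to their span by linearity. *)
have gv : \sum_k dotv (g k) v = 0 /\ \sum_k dotv (g k) v *: x k = v.
  move: vV; set s := map _ _ => vV.
  have ss : size s == 3 by rewrite size_map size_enum_ord.
  have := @coord_span _ _ _ (Tuple ss) v vV.
  set a := fun i => coord (Tuple ss) i v.
  have -> : \sum_(i < 3) coord (Tuple ss) i v *: (Tuple ss)`_i
     = \sum_i a i *: b i.
    apply: eq_bigr => i _.
    by rewrite (nth_map i) ?size_enum_ord// nth_ord_enum.
  move=> {1 2 3}->.
  have e k : dotv (g k) (\sum_i a i *: b i) = \sum_i a i * dotv (g k) (b i).
    by rewrite dotv_sumr; apply: eq_bigr => i _; rewrite dotvZr.
  split.
    under eq_bigr do rewrite e.
    rewrite exchange_big big1//= => i _.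
    by rewrite -mulr_sumr g0 mulr0.
  under eq_bigr do rewrite e scaler_suml.
  rewrite exchange_big; apply: eq_bigr => i _ /=.
  under eq_bigr do rewrite -scalerA.
  by rewrite -scaler_sumr gx.
have -> : \sum_k (enorm (g k) / T) *: x k + v =
    \sum_k (enorm (g k) / T + dotv (g k) v) *: x k.
  rewrite -{1}gv.2 -big_split; apply: eq_bigr => k _ /=.
  by rewrite scalerDl.
apply: convex_set_sum_fin => //.
- move=> k; have := dotv_le_enorm (g k) v; rewrite ler_norml => /andP[+ _].
  have : enorm (g k) * enorm v <= enorm (g k) / T.
    by rewrite ler_wpM2l// enorm_ge0.
  lra.
- by rewrite big_split/= gv.1 addr0 -mulr_suml mulfV.
Qed.

End Radii.

(** * The minimal enclosing ball *)

(** [t] is the least ratio [a i / - b i] over the negative [b i], the time at which a first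
    coordinate vanishes. *)
Lemma nonneg_shift (R : realFieldType) k (a b : 'I_k -> R) :
  (forall i, 0 <= a i) -> (exists i, b i < 0) ->
  exists t, exists i0,
    [/\ 0 <= t, forall i, 0 <= a i + t * b i & a i0 + t * b i0 = 0].
Proof.
move=> a0 [i1 i1n].
pose t i := a i / - b i.
have [i0 i0n ti0] := @arg_minP _ _ _ i1 (fun i => b i < 0) t i1n.
have t0 : 0 <= t i0 by rewrite divr_ge0// oppr_ge0 ltW.
exists (t i0), i0; split => //.
- move=> i; have [n|n] := ltP (b i) 0; last by rewrite addr_ge0// mulr_ge0.
  have := ti0 i n; rewrite -(ler_pM2r (_ : 0 < - b i)) ?oppr_gt0//.
  by rewrite {2}/t divfK ?oppr_eq0 ?lt_eqF// mulrN; lra.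
- by rewrite /t invrN mulrN mulNr divfK ?subrr// lt_eqF.
Qed.

Section Contact.
Variables (R : realType) (m : nat).

Definition wmean k (a : 'I_k -> R) (p : 'I_k -> 'rV[R]_m) : 'rV[R]_m :=
  \sum_i a i *: p i.

Definition wvar k (a : 'I_k -> R) (p : 'I_k -> 'rV[R]_m) : R :=
  \sum_i a i * dotv (p i) (p i) - dotv (wmean a p) (wmean a p).

Lemma wvarE k (a : 'I_k -> R) (p : 'I_k -> 'rV[R]_m) : \sum_i a i = 1 ->
  wvar a p = \sum_i a i * dotv (p i - wmean a p) (p i - wmean a p).
Proof.
move=> a1; set c := wmean a p.
have e i : a i * dotv (p i - c) (p i - c) = a i * dotv (p i) (p i) +
    ((-2) * dotv (a i *: p i) c + a i * dotv c c).
  by rewrite !dotv_lin (dotvC c); ring.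
under [RHS]eq_bigr do rewrite e.
rewrite !big_split/= -mulr_sumr -mulr_suml a1 -dotv_suml -/(wmean a p) -/c.
by rewrite /wvar -/c; ring.
Qed.

(** The weights move along an affine dependence of the points, which fixes total mass and mean,
    until one of them vanishes. *)
Lemma caratheodory (a : 'I_m.+2 -> R) (p : 'I_m.+2 -> 'rV[R]_m) :
  (forall i, 0 <= a i) -> \sum_i a i = 1 ->
  exists i0, exists b : 'I_m.+2 -> R,
    [/\ forall i, 0 <= b i, \sum_i b i = 1, b i0 = 0,
        wmean b p = wmean a p & wvar a p <= wvar b p].
Proof.
move=> a0 a1.
(* [N] has [m.+2] rows and [m + 1] columns, so its rows are dependent; the column of ones makes the
   dependence affine. *)
pose N : 'M[R]_(m.+2, m + 1) := row_mx (\matrix_i p i) (const_mx 1).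
have k0 : kermx N != 0.
  rewrite -mxrank_eq0 mxrank_ker -lt0n subn_gt0.
  by rewrite (leq_ltn_trans (rank_leq_col _))// addn1.
have [j kj] : exists j, row j (kermx N) != 0.
  apply/not_existsP => h; move/eqP: k0; apply; apply/row_matrixP => j.
  by have /negP := h j; rewrite negbK row0 => /eqP.
set al := row j (kermx N) in kj.
have : al *m N = 0 by rewrite -row_mul mulmx_ker row0.
rewrite mul_mx_row -[RHS]row_mx0 => /eq_row_mx[alp al1].
have {alp} alp : \sum_i al 0 i *: p i = 0.
  by rewrite -[RHS]alp mulmx_sum_row; apply: eq_bigr => i _; rewrite rowK.
have {}al1 : \sum_i al 0 i = 0.
  move/matrixP: al1 => /(_ 0 0); rewrite [LHS]mxE [RHS]mxE => h.
  rewrite -[RHS]h; by apply: eq_bigr => i _; rewrite !mxE mulr1.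
(* The sign of the dependence is chosen so that the second moment, hence the variance, does not
   decrease. *)
wlog s0 : al kj alp al1 / 0 <= \sum_i al 0 i * dotv (p i) (p i).
  move=> wl; have [|/ltW s0] := leP 0 (\sum_i al 0 i * dotv (p i) (p i)).
    exact: wl.
  apply: (wl (- al)); first by rewrite oppr_eq0.
  - under eq_bigr do rewrite mxE scaleNr.
    by rewrite sumrN alp oppr0.
  - under eq_bigr do rewrite mxE.
    by rewrite sumrN al1 oppr0.
  - under eq_bigr do rewrite mxE mulNr.
    by rewrite sumrN oppr_ge0.
have [i1 i1n] : exists i, al 0 i < 0.
  apply/not_existsP => h; move/eqP: kj; apply; apply/rowP => i; rewrite mxE.
  have p0 l : true -> 0 <= al 0 l by move=> _; rewrite leNgt; apply/negP/h.
  move/eqP: al1; rewrite psumr_eq0// => /allP/(_ i (mem_index_enum i)).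
  by move/eqP.
have [t [i0 [t0 shift_ge0 shift0]]] :=
  nonneg_shift a0 (ex_intro (fun i => al 0 i < 0) i1 i1n).
exists i0, (fun i => a i + t * al 0 i).
have mE : wmean (fun i => a i + t * al 0 i) p = wmean a p.
  rewrite /wmean; under eq_bigr do rewrite scalerDl -scalerA.
  by rewrite big_split/= -scaler_sumr alp scaler0 addr0.
split=> //.
- by rewrite big_split/= -mulr_sumr al1 mulr0 addr0.
- rewrite /wvar mE lerD2r; under [leRHS]eq_bigr do rewrite mulrDl -mulrA.
  by rewrite big_split/= lerDl -mulr_sumr mulr_ge0.
Qed.

Import ArrowAsProduct.

(* Among the probability measures carried by [m.+1] points of [P], one of maximal
   variance will do: moving mass towards any further point of [P] cannot increase
   the variance. *)
Lemma minimal_enclosing_ball (P : set 'rV[R]_m) : compact P -> P !=set0 ->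
  exists (a : 'I_m.+1 -> R) (p : 'I_m.+1 -> 'rV[R]_m) (rho : R),
    [/\ forall i, 0 <= a i, \sum_i a i = 1, forall i, P (p i) /\ 0 <= rho,
        forall q, P q -> dotv (q - wmean a p) (q - wmean a p) <= rho ^+ 2 &
        forall i, 0 < a i ->
          dotv (p i - wmean a p) (p i - wmean a p) = rho ^+ 2].
Proof.
move=> cP [q0 Pq0].
(* A measure is encoded as a family of pairs of weight and position, so that Tychonoff gives
   compactness. *)
pose T (i : 'I_m.+1) : topologicalType := (R * 'rV[R]_m)%type.
pose A1 := [set f : forall i, T i | forall i, (`[0, 1]%classic `*` P) (f i)].
pose sm (f : forall i, T i) : R := \sum_i (f i).1.
pose A := A1 `&` [set f | sm f = 1].
have cproj i : continuous (fun f : forall i, T i => f i) by exact: proj_continuous.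
have cfst i : continuous (fun f : forall i, T i => (f i).1).
  by move=> f; apply: (@continuous_comp _ _ _ (fun f => f i) fst); [exact: cproj|exact: cvg_fst].
have csnd i : continuous (fun f : forall i, T i => (f i).2).
  by move=> f; apply: (@continuous_comp _ _ _ (fun f => f i) snd); [exact: cproj|exact: cvg_snd].
have cA : compact A.
  apply: compact_closedI.
    apply: (@tychonoff _ T (fun=> `[0, 1]%classic `*` P)) => i.
    by apply: compact_setX => //; exact: segment_compact.
  have csm : continuous sm by apply: continuous_sum.
  apply: (@preimage_closed _ _ sm [set 1]).
    by move=> x _; exact: csm.
  exact: closed_eq.
have A0 : A !=set0.
  exists (fun i => if i == ord0 then (1, q0) else (0, q0)); split.
    by move=> i; case: ifP => _; split=> //=; rewrite in_itv/= ?lexx ?ler01.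
  by rewrite /sm/= (bigD1 ord0)//= big1 ?addr0// => i /negbTE ->.
pose F (f : forall i, T i) := wvar (fun i => (f i).1) (fun i => (f i).2).
have cF : continuous F.
  have c1 : continuous (fun f : forall i, T i =>
      \sum_i (f i).1 * dotv (f i).2 (f i).2).
    apply: continuous_sum => i; apply: continuous_mul; first exact: cfst.
    exact: (continuous_dotv (csnd i) (csnd i)).
  have cm : continuous (fun f : forall i, T i =>
      wmean (fun i => (f i).1) (fun i => (f i).2)).
    apply: continuous_sum => i.
    by apply: continuous_scale; [exact: cfst|exact: csnd].
  exact: (continuous_sub c1 (continuous_dotv cm cm)).
have [f /set_mem[Af sf] fmax] :=
  compact_EVT_max A0 cA (continuous_subspaceT cF).
have {}Af i : 0 <= (f i).1 /\ P (f i).2.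
  by have [/=] := Af i; rewrite in_itv/= => /andP[].
pose a i := (f i).1; pose p i := (f i).2.
have FE : F f = wvar a p by [].
have v0 : 0 <= wvar a p.
  rewrite wvarE//; apply: sumr_ge0 => i _.
  by rewrite mulr_ge0 ?dotv_ge0//; case: (Af i).
exists a, p, (Num.sqrt (wvar a p)); rewrite sqr_sqrtr//.
have hP q : P q -> dotv (q - wmean a p) (q - wmean a p) <= wvar a p.
  move=> Pq; set D := dotv _ _.
  have D0 : 0 <= D := dotv_ge0 _.
  (* Mixing mass [e] at [q] into the measure gives variance [(1 - e) * wvar a p + e * (1 - e) * D];
     [caratheodory] cuts back to [m.+1] points without lowering it, and maximality applies. *)
  have key e : 0 <= e <= 1 -> e * (1 - e) * D <= e * wvar a p.
    move=> /andP[e0 e1].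
    pose a' (i : 'I_m.+2) := if unlift ord_max i is Some j then (1 - e) * a j
                             else e.
    pose p' (i : 'I_m.+2) := if unlift ord_max i is Some j then p j else q.
    have bigE (W : nmodType) (G : 'I_m.+2 -> W) :
        \sum_i G i = \sum_(i < m.+1) G (lift ord_max i) + G ord_max.
      rewrite big_ord_recr; congr (_ + _); apply: eq_bigr => i _.
      by congr G; apply/val_inj; rewrite /= /bump leqNgt ltn_ord.
    have a'0 i : 0 <= a' i.
      rewrite /a'; case: unlift => [j|//].
      by rewrite mulr_ge0 ?subr_ge0//; case: (Af j).
    have a'1 : \sum_i a' i = 1.
      rewrite bigE /a' unlift_none; under eq_bigr do rewrite liftK.
      by rewrite -mulr_sumr [X in _ * X]sf mulr1 subrK.
    have m' : wmean a' p' = (1 - e) *: wmean a p + e *: q.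
      rewrite /wmean bigE /a' /p' unlift_none.
      under eq_bigr do rewrite liftK -scalerA.
      by rewrite -scaler_sumr.
    have v' : wvar a' p' = (1 - e) * wvar a p + e * (1 - e) * D.
      rewrite {1}/wvar m' bigE /a' /p' unlift_none.
      under eq_bigr do rewrite liftK -mulrA.
      rewrite -mulr_sumr /wvar /D !dotv_lin (dotvC q); ring.
    have [i0 [b [b0 b1 bi bm bv]]] := caratheodory p' a'0 a'1.
    pose g : forall i, T i := fun i => (b (lift i0 i), p' (lift i0 i)).
    have bigL (W : nmodType) (G : 'I_m.+2 -> W) :
        G i0 = 0 -> \sum_i G i = \sum_(i < m.+1) G (lift i0 i).
      by move=> G0; rewrite (bigD1_ord i0)//= G0 add0r.
    have sg : sm g = 1 by rewrite /sm/= -b1 bigL.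
    have Ag : A g.
      split=> // i; split; last by rewrite /= /p'; case: unlift => // j; case: (Af j).
      rewrite /= in_itv/= b0/= -sg /sm (bigD1 i)//= lerDl.
      by apply: sumr_ge0 => l _.
    have Fg : F g = wvar b p'.
      rewrite /F /wvar /wmean/= !bigL ?bi ?scale0r ?mul0r//.
    have := fmax g (mem_set Ag); rewrite FE Fg => le1.
    have := le_trans bv le1; rewrite v'; lra.
  rewrite leNgt; apply/negP => lt.
  have Dp : 0 < D by apply: le_lt_trans lt.
  (* For this [e], [(1 - e) * D] is the midpoint of [D] and [wvar a p], so it exceeds [wvar a p]. *)
  pose e := (D - wvar a p) / (2 * D).
  have eE : e * (2 * D) = D - wvar a p.
    by rewrite /e divfK// mulf_neq0 ?gt_eqF ?ltr0n.
  have e0 : 0 < e by rewrite divr_gt0 ?subr_gt0// mulr_gt0.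
  have e1 : e <= 1 by nra.
  have := key e; rewrite ltW//= e1 -mulrA ler_pM2l// => /(_ isT); nra.
split=> //.
- by move=> i; case: (Af i).
- by move=> i; split; [case: (Af i)|exact: sqrtr_ge0].
move=> i ai; apply/eqP; rewrite eq_le; apply/andP; split.
  by apply: hP; case: (Af i).
rewrite leNgt; apply/negP => lt.
(* The variance is the weighted mean of squared distances, none above it; a smaller one of positive
   weight would lower the mean. *)
suff : wvar a p < wvar a p by rewrite ltxx.
rewrite {1}wvarE// -[ltRHS]mul1r -[X in X * wvar a p]sf mulr_suml.
rewrite (bigD1 i)//= [ltRHS](bigD1 i)//=.
apply: ltr_leD; first by rewrite ltr_pM2l.
apply: ler_sum => j _; apply: ler_wpM2l; first by case: (Af j).
by apply: hP; case: (Af j).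
Qed.
End Contact.

(** * Tetrahedra inscribed in the sphere *)

Section Face.
Variable (R : realType).
Implicit Types (n : 'rV[R]_3).

(** When the inner product equals [-5/11], the right side is the left side plus [8/11 (s - t)^2];
    [3/11] is half of [1 - 5/11]. *)
Lemma pair_norm_ge n (wa wb : 'rV[R]_3) (d s t : R) : dotv n n = 1 ->
  dotv wa wa = 1 -> dotv wb wb = 1 -> dotv wa n = d -> dotv wb n = d ->
  - (5 / 11) <= dotv wa wb -> 0 <= s -> 0 <= t ->
  (s + t) ^+ 2 * (3 / 11 - d ^+ 2) <=
    dotv (s *: (wa - d *: n) + t *: (wb - d *: n))
         (s *: (wa - d *: n) + t *: (wb - d *: n)).
Proof.
move=> nn waa wbb wan wbn kab s0 t0.
rewrite !dotv_lin (dotvC n wa) (dotvC n wb) (dotvC wb wa) nn waa wbb wan wbn.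
have st : 0 <= s * t by rewrite mulr_ge0.
have h : 0 <= s * t * (dotv wa wb + 5 / 11).
  by rewrite mulr_ge0//; lra.
have := sqr_ge0 (s - t); nra.
Qed.

Section OneFace.
(** A tetrahedron inscribed in the unit sphere with weighted barycentre 0: the face [w] lies at
    height [d] along the unit normal [n], the apex [w4] at height [- e], and [y] is the face
    projected along [n]. *)
Variables (y : 'I_3 -> 'rV[R]_3) (w : 'I_3 -> 'rV[R]_3) (w4 n : 'rV[R]_3).
Variables (m : 'I_3 -> R) (m4 d e : R).
Hypothesis nn : dotv n n = 1.
Hypothesis ww : forall j, dotv (w j) (w j) = 1.
Hypothesis w44 : dotv w4 w4 = 1.
Hypothesis wn : forall j, dotv (w j) n = d.
Hypothesis w4n : dotv w4 n = - e.
Hypothesis m0 : forall j, 0 < m j.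
Hypothesis m40 : 0 < m4.
Hypothesis m41 : m4 <= 5 / 16.
Hypothesis sm : \sum_j m j = 1 - m4.
Hypothesis smw : \sum_j m j *: w j = - (m4 *: w4).
Hypothesis d0 : 0 <= d.
Hypothesis kw : forall i j, - (5 / 11) <= dotv (w i) (w j).
Hypothesis kw4 : forall i, - (5 / 11) <= dotv (w i) w4.
Hypothesis yE : forall j, y j = w j - d *: n.

Lemma face_e : m4 * e = d * (1 - m4).
Proof.
have := congr1 (fun v => dotv v n) smw.
rewrite /= dotv_suml dotvNl dotvZl w4n mulrN opprK => <-.
by rewrite -sm mulr_sumr; apply: eq_bigr => j _; rewrite dotvZl wn mulrC.
Qed.

Lemma face_e_ge0 : 0 <= e.
Proof.
by rewrite -(pmulr_rge0 _ m40) face_e mulr_ge0//; move: m41; lra.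
Qed.

Lemma face_e_le1 : e <= 1.
Proof.
have := dotv_CS w4 n; rewrite w4n w44 nn sqrrN mulr1 => h.
by rewrite -(expr_le1 (_ : 0 < 2)%N) ?face_e_ge0.
Qed.

Lemma face_d_le : d * (1 - m4) <= m4.
Proof. by rewrite -face_e ler_piMr// ?face_e_le1// ltW. Qed.

(** [d <= m4 / (1 - m4)], which is at most [5/11] because [m4 <= 5/16]. *)
Lemma face_d_sqr : d ^+ 2 <= 25 / 121.
Proof.
have := face_d_le; have d1 : d * (11 / 16) <= d * (1 - m4).
  by rewrite ler_wpM2l//; move: m41; lra.
move=> h; have h2 : d <= 5 / 11 by move: m41; lra.
rewrite (_ : 25 / 121 = (5 / 11) ^+ 2); last by field.
by rewrite ler_pXn2r// ?nnegrE//; lra.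
Qed.

Lemma face_y_sqr j : dotv (y j) (y j) = 1 - d ^+ 2.
Proof. by rewrite yE !dotv_lin (dotvC n) nn ww wn; ring. Qed.

Lemma face_sum_y : \sum_j m j *: y j = - (m4 *: (w4 + e *: n)).
Proof.
under eq_bigr do rewrite yE scalerBr scalerA.
rewrite sumrB -scaler_suml -mulr_suml sm smw [_ * d]mulrC -face_e.
by rewrite -scalerA scalerDr opprD.
Qed.

(** The three [y j] lie in the plane orthogonal to [n], so the matrix they form is singular. *)
Lemma face_rel : exists2 nu : 'I_3 -> R,
  exists i, nu i != 0 & \sum_j nu j *: y j = 0.
Proof.
pose W := \matrix_j y j.
have nW : n *m W^T = 0.
  apply/rowP => j; rewrite [RHS]mxE.
  have -> : (n *m W^T) 0 j = dotv n (y j).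
    by rewrite mxE; apply: eq_bigr => l _; rewrite !mxE.
  by rewrite yE !dotv_lin nn dotvC wn; ring.
have k0 : kermx W != 0.
  rewrite kermx_eq0 row_free_unit -unitmx_tr; apply/negP => Wu.
  have : n = 0 by rewrite -(mulmxK Wu n) nW mul0mx.
  by move=> n0; move: nn; rewrite n0 dotv0l => /esym/eqP; rewrite oner_eq0.
have [i ki] : exists i, row i (kermx W) != 0.
  apply/not_existsP => h; move/eqP: k0; apply; apply/row_matrixP => i.
  by have /negP := h i; rewrite negbK row0 => /eqP.
have kW : row i (kermx W) *m W = 0 by rewrite -row_mul mulmx_ker row0.
exists (fun j => row i (kermx W) 0 j).
  apply/not_existsP => h; move/eqP: ki; apply; apply/rowP => j.
  have hj := h j; move/negP: hj; rewrite negbK => /eqP ->; by rewrite mxE.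
by rewrite -[RHS]kW mulmx_sum_row; apply: eq_bigr => j _; rewrite rowK.
Qed.

Lemma sum3 (V : zmodType) (F : 'I_3 -> V) (i : 'I_3) :
  \sum_j F j = F i + F (lift i ord0) + F (lift i (lift ord0 ord0)).
Proof.
by rewrite (bigD1_ord i)//= !big_ord_recl big_ord0 addr0 addrA.
Qed.

(* Otherwise the weight [m4] of the fourth vector would be too large. *)
Lemma face_not_lone (nu : 'I_3 -> R) i : \sum_j nu j *: y j = 0 ->
  nu i < 0 -> (forall j, j != i -> 0 <= nu j) -> False.
Proof.
move=> nuy ni nj.
set a := lift i ord0; set b := lift i (lift ord0 ord0).
have na : 0 <= nu a by apply: nj; rewrite eq_sym neq_lift.
have nb : 0 <= nu b by apply: nj; rewrite eq_sym neq_lift.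
have nuy' : nu i *: y i + nu a *: y a + nu b *: y b = 0.
  by rewrite -[RHS]nuy (sum3 _ i).
pose p := nu a / - nu i; pose q := nu b / - nu i.
have p0 : 0 <= p by rewrite divr_ge0// oppr_ge0 ltW.
have q0 : 0 <= q by rewrite divr_ge0// oppr_ge0 ltW.
have yi : y i = p *: y a + q *: y b.
  have nin : - nu i != 0 by rewrite oppr_eq0 lt_eqF.
  apply: (scalerI nin); rewrite scalerDr !scalerA /p /q ![- _ * _]mulrC !divfK//.
  by apply/eqP; rewrite -subr_eq0 scaleNr -opprD oppr_eq0 addrA nuy'.
have Y0 : 0 < 1 - d ^+ 2 by have := face_d_sqr; lra.
(* The three vectors have equal norm, so the triangle inequality in [y i = p *: y a + q *: y b]
   forces this. *)
have pq : 1 <= p + q.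
  have h1 := dotv_CS (y a) (y b).
  rewrite !face_y_sqr -expr2 in h1.
  have h2 : dotv (y a) (y b) <= 1 - d ^+ 2.
    by apply: le_trans (ler_norm _) _; rewrite -ler_sqr ?nnegrE ?real_normK ?num_real// ltW.
  have := face_y_sqr i; rewrite yi !dotv_lin !face_y_sqr (dotvC (y b)).
  have h3 : p * q * dotv (y a) (y b) <= p * q * (1 - d ^+ 2).
    by rewrite ler_wpM2l// mulr_ge0.
  move=> h4; have h5 : 1 * (1 - d ^+ 2) <= (p + q) ^+ 2 * (1 - d ^+ 2) by lra.
  have : 1 <= (p + q) ^+ 2 by rewrite ler_pM2r in h5.
  by rewrite expr_ge1// addr_ge0.
(* Eliminating [y i] leaves [s *: y a + t *: y b] with [s + t >= 1 - m4]. Then [pair_norm_ge] and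
   [face_e] give [3/11 (1 - m4)^2 <= m4^2], false for [m4 <= 5/16]. *)
have := face_sum_y; rewrite (sum3 _ i) -/a -/b yi => h.
pose s := m a + m i * p; pose t := m b + m i * q.
have {h} h : s *: y a + t *: y b = - (m4 *: (w4 + e *: n)).
  rewrite -h scalerDr !scalerA /s /t !scalerDl.
  by rewrite addrACA addrC addrA.
have ml j : 0 <= m j by exact: ltW.
have s0 : 0 <= s by rewrite addr_ge0// mulr_ge0.
have t0 : 0 <= t by rewrite addr_ge0// mulr_ge0.
have st : 1 - m4 <= s + t.
  rewrite -sm (sum3 _ i) -/a -/b /s /t.
  have : m i * 1 <= m i * (p + q) by rewrite ler_wpM2l// ltW.
  lra.
have := pair_norm_ge nn (ww a) (ww b) (wn a) (wn b) (kw a b) s0 t0.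
rewrite -!yE h !dotv_lin nn w44 w4n (dotvC n) w4n.
have c0 : 0 <= 3 / 11 - d ^+ 2 by have := face_d_sqr; lra.
have h1 : (1 - m4) ^+ 2 * (3 / 11 - d ^+ 2) <= (s + t) ^+ 2 * (3 / 11 - d ^+ 2).
  rewrite ler_wpM2r// ler_pXn2r// ?nnegrE; last exact: addr_ge0.
  by move: m41; lra.
have h2 : (m4 * e) ^+ 2 = d ^+ 2 * (1 - m4) ^+ 2 by rewrite face_e exprMn.
have h3 : m4 ^+ 2 <= (5 / 16) ^+ 2.
  by rewrite ler_pXn2r// ?nnegrE; move: m40 m41; lra.
have h4 : (11 / 16) ^+ 2 <= (1 - m4) ^+ 2.
  by rewrite ler_pXn2r// ?nnegrE; move: m41; lra.
by nra.
Qed.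

(** The linear relation has no lone negative coefficient and, by a change of sign, no lone positive
    one; hence all signs agree and the foot of the centre lies in the face. *)
Lemma face_foot : exists nu : 'I_3 -> R,
  [/\ forall j, 0 <= nu j, \sum_j nu j = 1 & \sum_j nu j *: y j = 0].
Proof.
have [nu] := face_rel.
wlog [i pi] : nu / exists i, 0 < nu i.
  move=> wl [i ni] s0; have [p|p] := pselect (exists i, 0 < nu i).
    by apply: (wl nu) => //; exists i.
  apply: (wl (fun j => - nu j)).
  - exists i; rewrite oppr_gt0 lt_neqAle ni leNgt; apply/negP => h.
    by apply: p; exists i.
  - by exists i; rewrite oppr_eq0.
  - by under eq_bigr do rewrite scaleNr; rewrite sumrN s0 oppr0.
move=> _ s0.
have nu0 j : 0 <= nu j.
  rewrite leNgt; apply/negP => nj.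
  have [/forallP h|/forallPn[k]] := boolP [forall k, (k != j) ==> (0 <= nu k)].
    by apply: (face_not_lone s0 nj) => k; apply/implyP.
  rewrite negb_imply -ltNge => /andP[kj nk].
  apply: (@face_not_lone (fun j => - nu j) i).
  - by under eq_bigr do rewrite scaleNr; rewrite sumrN s0 oppr0.
  - by rewrite oppr_lt0.
  - move=> l li; rewrite oppr_ge0 leNgt; apply/negP => nl.
    have ij : i != j by apply/eqP => ij; move: nj; rewrite -ij ltNge ltW.
    have ik : i != k by apply/eqP => ik; move: nk; rewrite -ik ltNge ltW.
    have lj : l != j by apply/eqP => lj; move: nj; rewrite -lj ltNge ltW.
    have lk : l != k by apply/eqP => lk; move: nk; rewrite -lk ltNge ltW.
    (* [i], [j], [k], [l] would be four distinct elements of ['I_3]. *)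
    have := max_card [pred x | x \in [:: i; j; k; l]].
    rewrite card_ord; have /card_uniqP -> // : uniq [:: i; j; k; l].
    have [il jk] : i != l /\ j != k by rewrite eq_sym li eq_sym kj.
    have [jl kl] : j != l /\ k != l by rewrite eq_sym lj eq_sym lk.
    by rewrite /= !inE !negb_or ij ik il jk jl kl.
have sn : 0 < \sum_j nu j.
  by rewrite (bigD1 i)//= ltr_pwDl// sumr_ge0.
exists (fun j => nu j / \sum_j nu j); split.
- by move=> j; rewrite divr_ge0// ltW.
- by rewrite -mulr_suml mulfV// gt_eqF.
- under eq_bigr do rewrite mulrC -scalerA.
  by rewrite -scaler_sumr s0 scaler0.
Qed.

(** Shifting the weights along the relation of the [y j] until one vanishes writes [w4 + e *: n]
    through two vertices only. Its norm bounds [s + u] above by [pair_norm_ge], its product with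
    [w4] bounds [s + u] below; together they give [key]. *)
Lemma face_height :
  0 < d /\ m4 ^+ 2 <= d ^+ 2 * (33 * m4 ^+ 2 - 22 * m4 + 33 / 8).
Proof.
have e0 := face_e_ge0; have e1 := face_e_le1; have ee := face_e.
have dd := face_d_sqr.
have key : (3 / 11 - d ^+ 2) * (1 - e ^+ 2) <= (5 / 11 - d * e) ^+ 2.
  have [nu nu0 s0] := face_rel.
  wlog [i ni] : nu nu0 s0 / exists i, nu i < 0.
    move=> wl; have [i ni] := nu0.
    have [p|p] := pselect (exists i, nu i < 0); first exact: (wl nu).
    apply: (wl (fun j => - nu j)).
    - by exists i; rewrite oppr_eq0.
    - by under eq_bigr do rewrite scaleNr; rewrite sumrN s0 oppr0.
    - exists i; rewrite oppr_lt0 lt_neqAle eq_sym ni leNgt; apply/negP => h.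
      by apply: p; exists i.
  have al0 j : 0 <= m j / m4 by rewrite divr_ge0// ltW.
  have [t [k [t0 be0 bk]]] := nonneg_shift al0 (ex_intro _ i ni).
  have : \sum_j (m j / m4 + t * nu j) *: y j = - (w4 + e *: n).
    under eq_bigr do rewrite scalerDl [_ / _]mulrC -!scalerA.
    rewrite big_split/= -!scaler_sumr s0 scaler0 addr0 face_sum_y.
    by rewrite scalerN scalerA mulVf ?scale1r// gt_eqF.
  rewrite (sum3 _ k) bk scale0r add0r.
  set a := lift k ord0; set b := lift k _.
  move: (be0 a) (be0 b); set s := _ + _; set u := _ + _ => sg ug h.
  have h1 := pair_norm_ge nn (ww a) (ww b) (wn a) (wn b) (kw a b) sg ug.
  rewrite -!yE h !dotv_lin nn w44 w4n (dotvC n) w4n in h1.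
  have := congr1 (fun v => dotv v w4) h.
  rewrite /= !yE !dotv_lin w44 (dotvC n w4) w4n => h2.
  have h3 : 0 <= s * (dotv (w a) w4 + 5 / 11) by rewrite mulr_ge0//; have := kw4 a; lra.
  have h4 : 0 <= u * (dotv (w b) w4 + 5 / 11) by rewrite mulr_ge0//; have := kw4 b; lra.
  have f1 : 1 - e ^+ 2 <= (s + u) * (5 / 11 - d * e) by nra.
  have f2 : (s + u) ^+ 2 * (3 / 11 - d ^+ 2) <= 1 - e ^+ 2 by nra.
  have f0 : 0 <= 1 - e ^+ 2 by rewrite subr_ge0 expr_le1.
  have c0 : 0 <= 3 / 11 - d ^+ 2 by lra.
  have [->|fn] := eqVneq (1 - e ^+ 2) 0; first by rewrite mulr0 sqr_ge0.
  have fp : 0 < 1 - e ^+ 2 by rewrite lt0r fn.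
  have g1 : (1 - e ^+ 2) ^+ 2 <= ((s + u) * (5 / 11 - d * e)) ^+ 2.
    by rewrite ler_pXn2r// nnegrE// (le_trans f0).
  have g2 : (3 / 11 - d ^+ 2) * (1 - e ^+ 2) ^+ 2 <=
      (1 - e ^+ 2) * (5 / 11 - d * e) ^+ 2.
    apply: le_trans (ler_wpM2l c0 g1) _.
    rewrite exprMn mulrA [_ * (s + u) ^+ 2]mulrC.
    by rewrite ler_wpM2r// sqr_ge0.
  by rewrite -(ler_pM2l fp) mulrCA -expr2 (le_trans _ g2)// mulrC.
(* This is [key] expanded; multiplied by [m4 ^+ 2], it becomes the claim through
   [m4 * e = d * (1 - m4)]. *)
have k2 : 8 / 121 <= d ^+ 2 - (10 / 11) * d * e + (3 / 11) * e ^+ 2 by nra.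
have dn : d != 0.
  apply/eqP => dz; move: ee k2; rewrite dz mul0r => /eqP.
  by rewrite mulf_eq0 (gt_eqF m40)/= => /eqP ->; nra.
split; first by rewrite lt0r dn.
have m2 : 0 <= m4 ^+ 2 by rewrite sqr_ge0.
have := ler_wpM2l m2 k2.
have -> : m4 ^+ 2 * (d ^+ 2 - 10 / 11 * d * e + 3 / 11 * e ^+ 2) =
  m4 ^+ 2 * d ^+ 2 - 10 / 11 * d * m4 * (m4 * e) + 3 / 11 * (m4 * e) ^+ 2.
  by ring.
rewrite ee; lra.
Qed.

End OneFace.
End Face.

(** * Tetrahedra with no pair of far vertices *)

Section Tetrahedron.
Variables (R : realType) (w : 'I_4 -> 'rV[R]_3) (mu : 'I_4 -> R).
Hypothesis mu0 : forall i, 0 <= mu i.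
Hypothesis mu1 : \sum_i mu i = 1.
Hypothesis muw : \sum_i mu i *: w i = 0.
Hypothesis ww : forall i, 0 < mu i -> dotv (w i) (w i) = 1.
Hypothesis near : forall i j, 0 < mu i -> 0 < mu j ->
  - (5 / 11) < dotv (w i) (w j).

(** Pairing the barycentre relation with [w i] gives [mu i <= 5/11 (1 - mu i)]. *)
Lemma tetra_weight_le i : mu i <= 5 / 16.
Proof.
rewrite leNgt; apply/negP => lt.
have ip : 0 < mu i by apply: lt_trans lt.
have := congr1 (dotv (w i)) muw; rewrite dotv0r dotv_sumr (bigD1_ord i)//=.
rewrite dotvZr ww// mulr1 => h.
have : \sum_(j < 3) mu (lift i j) * - (5 / 11) <=
    \sum_(j < 3) dotv (w i) (mu (lift i j) *: w (lift i j)).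
  apply: ler_sum => j _; rewrite dotvZr.
  have [jp|] := ltP 0 (mu (lift i j)); first by rewrite ler_pM2l// ltW// near.
  move=> jn; have /eqP -> : mu (lift i j) == 0 by rewrite eq_le jn mu0.
  by rewrite !mul0r.
have := mu1; rewrite (bigD1_ord i)//= -mulr_suml => s1.
lra.
Qed.

Lemma tetra_weight_gt0 i : 0 < mu i.
Proof.
have := mu1; rewrite (bigD1_ord i)//= (sum3 _ ord0).
have := tetra_weight_le (lift i ord0).
have := tetra_weight_le (lift i (lift ord0 ord0)).
have := tetra_weight_le (lift i (lift ord0 (lift ord0 ord0))).
lra.
Qed.

Lemma tetra_unit i : dotv (w i) (w i) = 1.
Proof. by rewrite ww// tetra_weight_gt0. Qed.

Lemma tetra_inner_ge i j : - (5 / 11) <= dotv (w i) (w j).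
Proof. by rewrite ltW// near// tetra_weight_gt0. Qed.

Lemma tetra_sum_face i : \sum_j mu (lift i j) = 1 - mu i.
Proof. by have := mu1; rewrite (bigD1_ord i)//= => <-; rewrite addrAC subrr add0r. Qed.

Lemma tetra_sumw_face i :
  \sum_j mu (lift i j) *: w (lift i j) = - (mu i *: w i).
Proof.
have := muw; rewrite (bigD1_ord i)//= => /eqP.
by rewrite addrC addr_eq0 => /eqP.
Qed.

Lemma tetra_normal i : exists n d,
  [/\ dotv n n = 1, 0 <= d & forall j, dotv (w (lift i j)) n = d].
Proof.
have [n [nn h]] := exists_unit_orthogonal
  (col_mx (w (lift i (lift ord0 ord0)) - w (lift i ord0))
     (w (lift i (lift ord0 (lift ord0 ord0))) - w (lift i ord0)))
  (isT : (2 < 3)%N).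
have h1 := h (lshift _ ord0); have h2 := h (rshift _ ord0).
rewrite rowKu row_id dotvDr dotvNr in h1.
rewrite rowKd row_id dotvDr dotvNr in h2.
have hd j : dotv (w (lift i j)) n = dotv (w (lift i ord0)) n.
  rewrite !(dotvC _ n); case: j => [[|[|[|]]]//= jl].
  - by congr (dotv _ (w (lift i _))); apply/val_inj.
  - transitivity (dotv n (w (lift i (lift ord0 ord0)))); last lra.
    by congr (dotv _ (w (lift i _))); apply/val_inj.
  - transitivity (dotv n (w (lift i (lift ord0 (lift ord0 ord0))))); last lra.
    by congr (dotv _ (w (lift i _))); apply/val_inj.
have [d0|/ltW d0] := leP 0 (dotv (w (lift i ord0)) n).
  by exists n, (dotv (w (lift i ord0)) n).
exists (- n), (- dotv (w (lift i ord0)) n); split.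
- by rewrite !dotv_lin opprK.
- by rewrite oppr_ge0.
- by move=> j; rewrite dotvNr hd.
Qed.

Lemma tetra_face i : exists n d,
  [/\ dotv n n = 1, 0 < d, forall j, dotv (w (lift i j)) n = d,
      mu i * dotv (w i) n = - (d * (1 - mu i)) &
   [/\ mu i ^+ 2 <= d ^+ 2 * (33 * mu i ^+ 2 - 22 * mu i + 33 / 8),
      d * (1 - mu i) <= mu i &
      exists nu : 'I_3 -> R, [/\ forall j, 0 <= nu j, \sum_j nu j = 1 &
        \sum_j nu j *: (w (lift i j) - d *: n) = 0]]].
Proof.
have [n [d [nn d0 wn]]] := tetra_normal i.
pose e := - dotv (w i) n.
have we : dotv (w i) n = - e by rewrite opprK.
have wl j := tetra_unit (lift i j).
have ml j := tetra_weight_gt0 (lift i j).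
have kw j k := tetra_inner_ge (lift i j) (lift i k).
have kw4 j := tetra_inner_ge (lift i j) i.
have yE j : (fun j => w (lift i j) - d *: n) j = w (lift i j) - d *: n by [].
clearbody e.
have [dp h] := face_height nn wl (tetra_unit i) wn we ml
  (tetra_weight_gt0 i) (tetra_weight_le i) (tetra_sum_face i)
  (tetra_sumw_face i) d0 kw kw4 yE.
exists n, d; split=> //.
  have h' : mu i * e = _ := face_e wn we (tetra_sum_face i) (tetra_sumw_face i).
  by rewrite we mulrN h'.
split=> //.
  exact: (face_d_le nn (tetra_unit i) wn we (tetra_weight_gt0 i)
    (tetra_weight_le i) (tetra_sum_face i) (tetra_sumw_face i) d0).
exact: (face_foot nn wl (tetra_unit i) wn we ml
  (tetra_weight_gt0 i) (tetra_weight_le i) (tetra_sum_face i)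
  (tetra_sumw_face i) d0 kw yE).
Qed.

(* The bound is an affine majorant, on [1/5, 5/16], of the value
   [sqrt (33 m^2 - 22 m + 33/8)] given by [face_height]; the four bounds add up
   to [437/125] because the weights sum to 1. *)
Lemma tetra_gradient i : 1 / 5 <= mu i ->
  exists g : 'rV[R]_3, [/\ forall j, dotv g (w j) = (i == j)%:R - mu i
     & enorm g <= 3233 / 2000 - 297 / 100 * mu i].
Proof.
move=> m5; have [n [d [nn d0 wn wi [h _ _]]]] := tetra_face i.
have m16 := tetra_weight_le i.
have mp := tetra_weight_gt0 i.
(* The gradient of the barycentric coordinate of vertex [i], whose value at the centre is [mu i] and
   which vanishes on the opposite face. *)
exists (- (mu i / d) *: n); split.
  move=> j; rewrite dotvZl; have [j' ->|->] := unliftP i j.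
    rewrite (negbTE (neq_lift _ _)) dotvC wn sub0r.
    by rewrite mulNr divfK// gt_eqF.
  rewrite eqxx dotvC mulNr mulrAC wi mulNr opprK.
  by rewrite [d * _]mulrC mulfK// gt_eqF.
rewrite enormZ /enorm nn sqrtr1 mulr1 normrN gtr0_norm ?divr_gt0//.
have b0 : 0 <= 3233 / 2000 - 297 / 100 * mu i by lra.
have bd : 0 <= (3233 / 2000 - 297 / 100 * mu i) * d by rewrite mulr_ge0// ltW.
rewrite ler_pdivrMr// -ler_sqr ?nnegrE ?(ltW mp)// exprMn mulrC.
apply: le_trans h _; apply: ler_wpM2l; first exact: sqr_ge0.
have : 0 <= (mu i - 1 / 5) * (5 / 16 - mu i) by rewrite mulr_ge0// subr_ge0.
by move: m5 m16; move: (mu i) => x m5' m16'; lra.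
Qed.

(** If all weights are at least [1/5], the gradients of [tetra_gradient] serve. A weight below [1/5]
    forces [d <= 1/4], so the opposite face has squared circumradius [1 - d ^+ 2 >= 15/16]. *)
Lemma tetra_cases :
  (exists g : 'I_4 -> 'rV[R]_3,
     (forall i j, dotv (g i) (w j) = (i == j)%:R - mu i) /\
     \sum_i enorm (g i) <= 437 / 125) \/
  (exists i : 'I_4, exists Y, exists (y : 'I_3 -> 'rV[R]_3) (nu : 'I_3 -> R),
     [/\ 15 / 16 <= Y, forall j, dotv (y j) (y j) = Y,
         forall j k, y j - y k = w (lift i j) - w (lift i k),
         (forall j, 0 <= nu j) /\ \sum_j nu j = 1 &
         \sum_j nu j *: y j = 0]).
Proof.
have [/forallP m5|] := boolP [forall i, 1 / 5 <= mu i].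
  left; have /choice[g hg] : forall i : 'I_4, exists g : 'rV[R]_3,
      (forall j, dotv g (w j) = (i == j)%:R - mu i) /\
      enorm g <= 3233 / 2000 - 297 / 100 * mu i.
    move=> i; have [g [g1 g2]] := tetra_gradient (m5 i).
    by exists g.
  exists g; split; first by move=> i j; have [-> _] := hg i.
  have : \sum_i enorm (g i) <= \sum_i (3233 / 2000 - 297 / 100 * mu i).
    by apply: ler_sum => i _; have [] := hg i.
  by rewrite sumrB sumr_const card_ord -mulr_sumr mu1 -mulr_natl; lra.
rewrite negb_forall => /existsP[i]; rewrite -ltNge => mi; right.
have [n [d [nn d0 wn _ [_ dm [nu [nu0 nu1 nuy]]]]]] := tetra_face i.
have mp := tetra_weight_gt0 i.
have d4 : d <= 1 / 4 by nra.
exists i, (1 - d ^+ 2), (fun j => w (lift i j) - d *: n), nu; split=> //.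
- nra.
- by move=> j; rewrite !dotv_lin (dotvC n) nn tetra_unit wn; ring.
- by move=> j k; rewrite opprB addrA subrK.
Qed.

End Tetrahedron.

(** * Acute triangles *)

(** For plane vectors [u], [v] the left sides are the squared norm of [p v - q u]. Divided by the
    largest in modulus of [p], [q], [p - q], this vector is up to sign a convex combination of two
    of the sides [u], [v], [u - v], taken with signs, and all sides have squared length at most
    [s]. *)
Lemma extent_cases (R : realFieldType) (p q uu vv uv s : R) :
  0 <= uu -> 0 <= vv -> uu <= s -> vv <= s -> uu + vv - 2 * uv <= s ->
  0 <= uu + vv - 2 * uv ->
  [\/ p ^+ 2 * vv + q ^+ 2 * uu - 2 * p * q * uv <= s * p ^+ 2,
      p ^+ 2 * vv + q ^+ 2 * uu - 2 * p * q * uv <= s * q ^+ 2 |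
      p ^+ 2 * vv + q ^+ 2 * uu - 2 * p * q * uv <= s * (p - q) ^+ 2].
Proof.
move=> u0 v0 us vs ws w0.
have [pq|pq] := leP 0 (p * q).
  have h : 0 <= p * q * (s - (uu + vv - 2 * uv)) by rewrite mulr_ge0// subr_ge0.
  have [pp|pp] := leP (p ^+ 2) (q ^+ 2).
  - have a1 : 0 <= q ^+ 2 - p * q by have := sqr_ge0 (p - q); nra.
    apply: Or32.
    have h1 : 0 <= (s - uu) * (q ^+ 2 - p * q) by rewrite mulr_ge0// subr_ge0.
    have a2 : p ^+ 2 <= p * q.
      rewrite -ler_sqr ?nnegrE ?sqr_ge0// exprMn -[leLHS]mulr1.
      have := ler_wpM2l (sqr_ge0 p) pp; lra.
    have h2 : 0 <= vv * (p * q - p ^+ 2) by rewrite mulr_ge0// subr_ge0.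
    lra.
  - have a1 : 0 <= p ^+ 2 - p * q by have := sqr_ge0 (p - q); nra.
    apply: Or31.
    have h1 : 0 <= (s - vv) * (p ^+ 2 - p * q) by rewrite mulr_ge0// subr_ge0.
    have a2 : q ^+ 2 <= p * q.
      rewrite -ler_sqr ?nnegrE ?sqr_ge0// exprMn -[leLHS]mulr1.
      have := ler_wpM2l (sqr_ge0 q) (ltW pp); lra.
    have h2 : 0 <= uu * (p * q - q ^+ 2) by rewrite mulr_ge0// subr_ge0.
    lra.
apply: Or33.
have h : 0 <= - (p * q) * (uu + vv - 2 * uv).
  by rewrite mulr_ge0// oppr_ge0 ltW.
have h1 : 0 <= (s - vv) * (p ^+ 2 - p * q).
  by rewrite mulr_ge0 ?subr_ge0//; have := sqr_ge0 p; lra.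
have h2 : 0 <= (s - uu) * (q ^+ 2 - p * q).
  by rewrite mulr_ge0 ?subr_ge0//; have := sqr_ge0 q; lra.
lra.
Qed.

Section Circumscribed.
Variables (R : realType) (y : 'I_3 -> 'rV[R]_3) (nu : 'I_3 -> R) (Y : R).
Let y0 := y ord0.
Let y1 := y (lift ord0 ord0).
Let y2 := y (lift ord0 (lift ord0 ord0)).
Hypothesis Y0 : 0 < Y.
Hypothesis yy : forall j, dotv (y j) (y j) = Y.
Hypothesis nu0 : forall j, 0 <= nu j.
Hypothesis nu1 : \sum_j nu j = 1.
Hypothesis nuy : \sum_j nu j *: y j = 0.

Lemma circ_inner_le i j : dotv (y i) (y j) <= Y.
Proof.
have h := dotv_CS (y i) (y j); rewrite !yy -expr2 in h.
apply: le_trans (ler_norm _) _.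
by rewrite -ler_sqr ?nnegrE ?real_normK ?num_real// ltW.
Qed.

Lemma circ_nu : nu ord0 + nu (lift ord0 ord0)
  + nu (lift ord0 (lift ord0 ord0)) = 1.
Proof. by rewrite -nu1 !big_ord_recl big_ord0 addr0 addrA. Qed.

Lemma circ_rel z : nu ord0 * dotv z y0 + nu (lift ord0 ord0) * dotv z y1
  + nu (lift ord0 (lift ord0 ord0)) * dotv z y2 = 0.
Proof.
have := congr1 (dotv z) nuy.
by rewrite dotv0r !big_ord_recl big_ord0 addr0 !dotv_lin addrA.
Qed.

(** Pairing the relation with the normals gives [nu j * gram3 = 0] for each [j], and the [nu j] sum
    to 1. *)
Lemma circ_gram3 : gram3 y0 y1 y2 = 0.
Proof.
rewrite -[LHS]mul1r -circ_nu !mulrDl.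
have -> : nu ord0 * gram3 y0 y1 y2 = 0.
  have := circ_rel (normal3 y0 y1 y2).
  by rewrite normal3_fst normal3_snd normal3_thd; lra.
have -> : nu (lift ord0 ord0) * gram3 y0 y1 y2 = 0.
  have := circ_rel (normal3 y1 y2 y0).
  by rewrite normal3_fst normal3_snd normal3_thd -gram3_rot; lra.
have := circ_rel (normal3 y2 y0 y1).
by rewrite normal3_fst normal3_snd normal3_thd gram3_rot; lra.
Qed.

(** Each weight is at most [1/2], by the triangle inequality in the relation. Products of the slacks
    [1 - 2 * a] with [Y - p] then combine linearly with the three relations. *)
Lemma circ_sum_inner : dotv y0 y1 + dotv y0 y2 + dotv y1 y2 <= - Y.
Proof.
have e0 := circ_rel y0; have e1 := circ_rel y1; have e2 := circ_rel y2.
rewrite !(dotvC y1 y0) !(dotvC y2 y0) !(dotvC y2 y1) !yy in e0 e1 e2.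
have c01 : dotv y0 y1 <= Y := circ_inner_le _ _.
have c02 : dotv y0 y2 <= Y := circ_inner_le _ _.
have c12 : dotv y1 y2 <= Y := circ_inner_le _ _.
have sn := circ_nu.
have n0 := nu0 ord0; have n1 := nu0 (lift ord0 ord0).
have n2 := nu0 (lift ord0 (lift ord0 ord0)).
move: e0 e1 e2 c01 c02 c12 sn n0 n1 n2.
set a := nu _; set b := nu _; set c := nu _.
set p := dotv y0 y1; set q := dotv y0 y2; set r := dotv y1 y2.
move=> e0 e1 e2 c01 c02 c12 sn n0 n1 n2.
have half (x z t d f g : R) : 0 <= x -> 0 <= z -> 0 <= t -> x + z + t = 1 ->
    d <= Y -> f <= Y -> g <= Y -> x * Y + z * d + t * f = 0 ->
    x * d + z * Y + t * g = 0 -> x * f + z * g + t * Y = 0 -> x <= 1 / 2.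
  move=> x0 z0 t0 s1 dY fY gY h1 h2 h3.
  rewrite leNgt; apply/negP => lt.
  have k1 : 0 <= z * t * (Y - g) by rewrite !mulr_ge0// subr_ge0.
  have k2 : x ^+ 2 * Y <= (z + t) ^+ 2 * Y.
    suff : x ^+ 2 * Y = z ^+ 2 * Y + t ^+ 2 * Y + 2 * z * t * g by nra.
    have j1 : x * (x * Y + z * d + t * f) = 0 by rewrite h1 mulr0.
    have j2 : z * (x * d + z * Y + t * g) = 0 by rewrite h2 mulr0.
    have j3 : t * (x * f + z * g + t * Y) = 0 by rewrite h3 mulr0.
    lra.
  rewrite ler_pM2r// ler_sqr ?nnegrE ?addr_ge0// in k2; lra.
have a2 : a <= 1 / 2 by apply: (half a b c p q r) => //; lra.
have b2 : b <= 1 / 2 by apply: (half b a c p r q) => //; lra.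
have c2 : c <= 1 / 2 by apply: (half c a b q r p) => //; lra.
have k1 : 0 <= (1 - 2 * a) * (1 - 2 * b) * (Y - p) by rewrite !mulr_ge0// subr_ge0//; lra.
have k2 : 0 <= (1 - 2 * a) * (1 - 2 * c) * (Y - q) by rewrite !mulr_ge0// subr_ge0//; lra.
have k3 : 0 <= (1 - 2 * b) * (1 - 2 * c) * (Y - r) by rewrite !mulr_ge0// subr_ge0//; lra.
have cE : c = 1 - a - b by lra.
rewrite cE in e0 e1 e2 k2 k3.
have j0 : a * (a * Y + b * p + (1 - a - b) * q) = 0 by rewrite e0 mulr0.
have j1 : b * (a * p + b * Y + (1 - a - b) * r) = 0 by rewrite e1 mulr0.
have j2 : (1 - a - b) * (a * q + b * r + (1 - a - b) * Y) = 0 by rewrite e2 mulr0.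
lra.
Qed.

Let u := y0 - y2.
Let v := y1 - y2.

(** The second identity is the square of the classical formula: product of the sides equals four
    times area times circumradius. It restates [circ_gram3]. *)
Lemma circ_sides :
  8 * Y <= dotv v v + dotv u u + dotv (u - v) (u - v) /\
  dotv v v * dotv u u * dotv (u - v) (u - v) = 4 * gram2 u v * Y.
Proof.
have h := circ_sum_inner; have g := circ_gram3.
move: h g; rewrite /gram3 /gram2 /u /v !dotv_lin.
rewrite !(dotvC y1 y0) !(dotvC y2 y0) !(dotvC y2 y1) !yy.
set p := dotv y0 y1; set q := dotv y0 y2; set r := dotv y1 y2.
move=> h g; split; first lra.
apply/eqP; rewrite -subr_eq0; apply/eqP.
by rewrite -[RHS](mulr0 (-4)) -g; ring.
Qed.

(** Otherwise the relation paired with [y j] makes every weight less than [1/3]. *)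
Lemma circ_far_pair : exists i j, dotv (y i) (y j) <= - (Y / 2).
Proof.
apply/not_existsP => h.
have k i j : - (Y / 2) < dotv (y i) (y j).
  by rewrite ltNge; apply/negP => le; apply: (h i); exists j.
have k01 : - (Y / 2) < dotv y0 y1 := k _ _.
have k02 : - (Y / 2) < dotv y0 y2 := k _ _.
have k12 : - (Y / 2) < dotv y1 y2 := k _ _.
have e0 := circ_rel y0; have e1 := circ_rel y1; have e2 := circ_rel y2.
rewrite !(dotvC y1 y0) !(dotvC y2 y0) !(dotvC y2 y1) !yy in e0 e1 e2.
have sn := circ_nu.
have n0 := nu0 ord0; have n1 := nu0 (lift ord0 ord0).
have n2 := nu0 (lift ord0 (lift ord0 ord0)).
have third (x z t d f : R) : 0 <= z -> 0 <= t -> x + z + t = 1 ->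
    - (Y / 2) < d -> - (Y / 2) < f -> x * Y + z * d + t * f = 0 -> x < 1 / 3.
  move=> z0 t0 s1 dY fY h1.
  have k1 : 0 <= z * (d + Y / 2) by rewrite mulr_ge0//; lra.
  have k2 : 0 <= t * (f + Y / 2) by rewrite mulr_ge0//; lra.
  rewrite ltNge; apply/negP => x3.
  have k3 : 0 <= (x - 1 / 3) * Y by rewrite mulr_ge0 ?subr_ge0// ltW.
  have xe : x = 1 - z - t by lra.
  rewrite xe in h1 k3.
  have z1 : z * (d + Y / 2) = 0 by lra.
  have t1 : t * (f + Y / 2) = 0 by lra.
  move/eqP: z1; rewrite mulf_eq0 => /orP[/eqP z1|/eqP]; last lra.
  move/eqP: t1; rewrite mulf_eq0 => /orP[/eqP t1|/eqP]; last lra.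
  by move: h1; rewrite z1 t1 !subr0 mul1r !mul0r !addr0 => Yz; move: Y0; rewrite Yz ltxx.
have a3 := third _ _ _ _ _ n1 n2 sn k01 k02 e0.
have b3 : nu (lift ord0 ord0) < 1 / 3.
  by apply: (third _ _ _ _ _ n0 n2 _ k01 k12); lra.
have c3 : nu (lift ord0 (lift ord0 ord0)) < 1 / 3.
  by apply: (third _ _ _ _ _ n0 n1 _ k02 k12); lra.
lra.
Qed.

End Circumscribed.

(* [s0], [s1], [s2] are the squared sides of an acute triangle of squared
   circumradius [Y], and [G] is sixteen times its squared area. *)
Lemma acute_triangle_bounds (R : realFieldType) (s0 s1 s2 s Y G X : R) :
  0 < s -> 0 <= s0 <= s -> 0 <= s1 <= s -> 0 <= s2 <= s ->
  165 / 512 * s <= Y -> 8 * Y <= s0 + s1 + s2 ->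
  G = 2 * (s0 * s1 + s0 * s2 + s1 * s2) - s0 ^+ 2 - s1 ^+ 2 - s2 ^+ 2 ->
  s0 * s1 * s2 = G * Y -> X = 3 * s - (s0 + s1 + s2) ->
  [/\ 0 <= X, X <= 17 / 165 * s, (3 * s + X) * (s - X) <= G & 0 < G].
Proof.
move=> sp /andP[s00 s0s] /andP[s10 s1s] /andP[s20 s2s] Ys Ysum G4 prod XE.
pose a := s - s0; pose b := s - s1; pose c := s - s2.
have a0 : 0 <= a by rewrite subr_ge0.
have b0 : 0 <= b by rewrite subr_ge0.
have c0 : 0 <= c by rewrite subr_ge0.
have XS : X = a + b + c by rewrite XE /a /b /c; lra.
have X0 : 0 <= X by rewrite XS; lra.
have Xs : X < s by lra.
have ab : 0 <= a * b by rewrite mulr_ge0.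
have ac : 0 <= a * c by rewrite mulr_ge0.
have bc : 0 <= b * c by rewrite mulr_ge0.
have GE : G = 3 * s ^+ 2 - 2 * s * X + X ^+ 2 - 2 * (a ^+ 2 + b ^+ 2 + c ^+ 2).
  by rewrite G4 XE /a /b /c; ring.
have gX : (3 * s + X) * (s - X) <= G by rewrite GE XS; lra.
have gp : 0 < G.
  by apply: lt_le_trans gX; rewrite mulr_gt0 ?subr_gt0// ltr_wpDr// mulr_gt0.
split=> //.
(* Divided by [G], this reads [Y * (3 * s + X) <= s ^+ 2]; the lower bound on [Y] turns it into the
   bound on [X], as [512/165 - 3 = 17/165]. *)
have key : G * Y * (3 * s + X) <= G * s ^+ 2.
  rewrite -prod -subr_ge0.
  have -> : G * s ^+ 2 - s0 * s1 * s2 * (3 * s + X) =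
      s * (a * b + a * c + b * c) * (s - X) + a * b * c * (3 * s + X).
    by rewrite GE XS /a /b /c; ring.
  apply: addr_ge0; apply: mulr_ge0; last lra.
  - by apply: mulr_ge0; [exact: ltW|lra].
  - by rewrite subr_ge0 ltW.
  - by apply: mulr_ge0.
rewrite -mulrA ler_pM2l// in key.
have h : 165 / 512 * s * (3 * s + X) <= s ^+ 2.
  apply: le_trans key; rewrite ler_wpM2r// addr_ge0// mulr_ge0// ltW//.
by rewrite -(ler_pM2l sp); lra.
Qed.

(** The lower bound on [g] leaves a comparison of two quadratics in [X], tightest at
    [X = 17/165 * s]. *)
Lemma final_ratio (R : realType) (s g X S : R) :
  0 < s -> 0 <= X -> X <= 17 / 165 * s -> (3 * s + X) * (s - X) <= 4 * g ->
  0 <= S -> S ^+ 2 * g * s <= (1007 / 200 * s - X / 2) ^+ 2 ->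
  S ^+ 2 * (11 / 32 * s) <= (197 / 56) ^+ 2.
Proof.
move=> sp X0 Xs gX S0 h.
have Xl : X < s by lra.
have gp : 0 < (3 * s + X) * (s - X).
  by rewrite mulr_gt0 ?subr_gt0// ltr_wpDr// mulr_gt0.
have h1 : S ^+ 2 * ((3 * s + X) * (s - X)) * s <=
    4 * (1007 / 200 * s - X / 2) ^+ 2.
  have : S ^+ 2 * ((3 * s + X) * (s - X)) * s <= S ^+ 2 * (4 * g) * s.
    by rewrite ler_wpM2r ?(ltW sp)// ler_wpM2l// sqr_ge0.
  lra.
have h2 : 4 * (1007 / 200 * s - X / 2) ^+ 2 * (11 / 32) <=
    (197 / 56) ^+ 2 * ((3 * s + X) * (s - X)).
  have : 0 <= X * (17 / 165 * s - X) by rewrite mulr_ge0// subr_ge0.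
  have : 0 <= s * (17 / 165 * s - X) by rewrite mulr_ge0 ?subr_ge0// ltW.
  have : 0 <= s * X by rewrite mulr_ge0// ltW.
  have : 0 <= s * s by rewrite mulr_ge0// ltW.
  lra.
rewrite -(ler_pM2r gp); apply: le_trans h2; lra.
Qed.

(** * Half-chords *)

(** Half the difference body, [(K - K) / 2]. *)
Definition half_chord (R : realType) (n : nat) (K : set 'rV[R]_n) :
  set 'rV[R]_n := [set 2^-1 *: (p.1 - p.2) | p in K `*` K].

Lemma gram2_frame (R : realType) (m n : nat) (E : 'M[R]_(m, n)) a b :
  E *m E^T = 1%:M -> b *m E^T = 0 ->
  dotv (a *m E^T) (a *m E^T) * dotv b b <= gram2 a b.
Proof.
move=> EE bE; have [->|b0] := eqVneq b 0.
  by rewrite /gram2 !dotv0r mulr0 mulr0 expr0n subr0.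
have bp := dotv_gt0 b0.
have := bessel EE (dotv b b *: a - dotv a b *: b).
rewrite mulmxBl -!scalemxAl bE scaler0 subr0 !dotv_lin (dotvC b a) => h.
by rewrite -(ler_pM2l bp) /gram2; lra.
Qed.

Section MaximalChords.
Variables (R : realType) (n : nat) (K : set 'rV[R]_n).
Hypotheses (cK : compact K) (K0 : K !=set0).

Lemma half_chord_compact : compact (half_chord K).
Proof.
apply: continuous_compact; last exact: compact_setX.
apply: continuous_subspaceT => p; apply: cvgZr.
by apply: cvgB; [exact: cvg_fst|exact: cvg_snd].
Qed.

Lemma maximal_gram3 : exists z1 z2 z3, [/\ half_chord K z1, half_chord K z2,
  half_chord K z3 & forall a b c, half_chord K a -> half_chord K b ->
  half_chord K c -> gram3 a b c <= gram3 z1 z2 z3].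
Proof.
pose A := half_chord K `*` half_chord K `*` half_chord K.
have cZ := half_chord_compact.
have cA : compact A by apply: compact_setX => //; exact: compact_setX.
have A0 : A !=set0.
  have [x Kx] := K0; have c0 : half_chord K (2^-1 *: (x - x)) by exists (x, x).
  by exists (2^-1 *: (x - x), 2^-1 *: (x - x), 2^-1 *: (x - x)).
pose T : topologicalType := ('rV[R]_n * 'rV[R]_n * 'rV[R]_n)%type.
have c1 : continuous (fun p : T => p.1.1).
  by move=> p; apply: (@continuous_comp _ _ _ fst fst); [exact: cvg_fst|exact: cvg_fst].
have c2 : continuous (fun p : T => p.1.2).
  by move=> p; apply: (@continuous_comp _ _ _ fst snd); [exact: cvg_fst|exact: cvg_snd].
have c3 : continuous (fun p : T => p.2) by move=> p; exact: cvg_snd.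
have cF : continuous (fun p : T => gram3 p.1.1 p.1.2 p.2).
  have d11 := continuous_dotv c1 c1; have d22 := continuous_dotv c2 c2.
  have d33 := continuous_dotv c3 c3; have d12 := continuous_dotv c1 c2.
  have d13 := continuous_dotv c1 c3; have d23 := continuous_dotv c2 c3.
  have g23 := continuous_sub (continuous_mul d22 d33) (continuous_mul d23 d23).
  have t1 := continuous_mul d11 g23.
  have ck : continuous (fun _ : T => 2 : R) by move=> p; exact: cvg_cst.
  have t2 := continuous_mul (continuous_mul (continuous_mul ck d23) d12) d13.
  have t3 := continuous_mul d22 (continuous_mul d13 d13).
  have t4 := continuous_mul d33 (continuous_mul d12 d12).
  have h := continuous_sub (continuous_sub t1 (continuous_sub t3 t2)) t4.
  apply: (eq_ind _ (fun F : T -> R => continuous F) h).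
  by apply/funext => p /=; rewrite /gram3 /gram2; ring.
have [[[z1 z2] z3] /set_mem[[h1 h2] h3] hm] :=
  compact_EVT_max A0 cA (continuous_subspaceT cF).
exists z1, z2, z3; split=> // a b c ha hb hc.
exact: (hm (a, b, c) (mem_set (conj (conj ha hb) hc))).
Qed.

End MaximalChords.

(** * Consequences of a small inner radius *)

Section Ratio.
Variables (R : realType) (K : set 'rV[R]_5).
Hypotheses (cK : compact K) (vK : convex_set K) (K0 : K !=set0).
Let D := outer_radius 3 K.
Hypothesis Dp : 0 < D.
Hypothesis rD : inner_radius 3 K < D / (197 / 56).

Lemma sum_enorm_gt (I : finType) (x g : I -> 'rV[R]_5)
    (b h : 'I_3 -> 'rV[R]_5) :
  (forall k, K (x k)) ->
  (forall i j, dotv (h i) (b j) = (i == j)%:R) ->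
  (forall j, \sum_k dotv (g k) (b j) = 0) ->
  (forall j, \sum_k dotv (g k) (b j) *: x k = b j) ->
  197 / 56 / D < \sum_k enorm (g k).
Proof.
move=> Kx hb g0 gx; rewrite ltNge; apply/negP => le.
have := inner_radius_ge_functionals cK vK Kx hb g0 gx le.
by rewrite leNgt invf_div rD.
Qed.

(* [8/11] is half of [1 + 5/11]: unit vectors with inner product at most [-5/11]
   have a half-difference of squared norm at least [8/11]. *)
Lemma frame_cases (E : 'M[R]_(3, 5)) : E *m E^T = 1%:M ->
  (exists2 z, half_chord K z & 8 / 11 * D ^+ 2 <= dotv (z *m E^T) (z *m E^T)) \/
  (exists (x : 'I_3 -> 'rV[R]_5) (y : 'I_3 -> 'rV[R]_3) (nu : 'I_3 -> R) Y,
     [/\ (forall j, K (x j)) /\ 15 / 16 * D ^+ 2 <= Y,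
         forall j, dotv (y j) (y j) = Y,
         forall j k, y j - y k = (x j - x k) *m E^T,
         (forall j, 0 <= nu j) /\ \sum_j nu j = 1 &
         \sum_j nu j *: y j = 0]).
Proof.
move=> EE.
pose P := [set x *m E^T | x in K].
have cE : continuous (fun x : 'rV[R]_5 => x *m E^T).
  under eq_fun do rewrite mulmx_sum_row.
  apply: continuous_sum => i.
  apply: (@continuous_scale _ _ _ (fun x : 'rV[R]_5 => x 0 i) (fun=> row i E^T)).
    exact: coord_continuous.
  exact: cst_continuous.
have cP : compact P by apply: continuous_compact cK; exact: continuous_subspaceT.
have P0 : P !=set0 by have [x Kx] := K0; exists (x *m E^T); exists x.
(* Four weighted points of the projection, those of positive weight on the sphere of its minimal
   ball; the radius is at least [D] because [D] is the infimum over all 3-spaces. *)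
have [a [p [rho [a0 a1 Pp hP hrho]]]] := minimal_enclosing_ball cP P0.
set c := wmean a p in hP hrho.
have rho0 : 0 <= rho by have [] := Pp ord0.
have Drho : D <= rho.
  by apply: (outer_radius_le_frame EE rho0) => x Kx; apply: hP; exists x.
have rp : 0 < rho by apply: lt_le_trans Drho.
have rn : rho != 0 by rewrite gt_eqF.
have /choice[x hx] : forall i, exists x, K x /\ x *m E^T = p i.
  by move=> i; have [[x Kx xp] _] := Pp i; exists x.
pose w i := rho^-1 *: (p i - c).
have wr i : rho *: w i = p i - c by rewrite scalerA mulfV// scale1r.
have wp i j : (x i - x j) *m E^T = rho *: (w i - w j).
  rewrite mulmxBl; have [_ ->] := hx i; have [_ ->] := hx j.
  by rewrite scalerBr !wr opprB addrA subrK.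
have ww i : 0 < a i -> dotv (w i) (w i) = 1.
  by move=> ai; rewrite /w dotvZl dotvZr hrho//; field.
have aw : \sum_i a i *: w i = 0.
  rewrite /w; under eq_bigr do rewrite scalerA mulrC -scalerA scalerBr.
  by rewrite -scaler_sumr sumrB -scaler_suml a1 scale1r subrr scaler0.
have DD : D ^+ 2 <= rho ^+ 2 by rewrite ler_pXn2r// nnegrE ltW.
clearbody w.
have [near|nnear] := pselect (forall i j, 0 < a i -> 0 < a j ->
    - (5 / 11) < dotv (w i) (w j)); last first.
  left; apply: contrapT => hn; apply: nnear => i j ai aj; rewrite ltNge.
  apply/negP => le; apply: hn; exists (2^-1 *: (x i - x j)).
    by exists (x i, x j) => //; split; [case: (hx i)|case: (hx j)].
  rewrite -scalemxAl wp !dotv_lin !ww// (dotvC (w j)).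
  have : 0 <= rho ^+ 2 * (- (5 / 11) - dotv (w i) (w j)).
    by rewrite mulr_ge0 ?sqr_ge0// subr_ge0.
  lra.
have [[g [gw gs]]|[i [Y [y [nu [Y0 yy yw [nu0 nu1] nuy]]]]]] :=
    tetra_cases a0 a1 aw ww near.
  exfalso.
  (* The gradients, carried into the span of [E], reproduce the edges from the four points; their
     norms sum to at most [437/125 / D], below [197/56 / D]. *)
  pose G i : 'rV[R]_5 := rho^-1 *: (g i *m E).
  have Gx k i j : dotv (G k) (x i - x j) = (k == i)%:R - (k == j)%:R.
    rewrite dotvZl dotvC -dotv_mulmx_tr wp !dotv_lin !(dotvC _ (g k)) !gw.
    by field.
  have hb (i j : 'I_3) : dotv (G (lift ord0 i)) (x (lift ord0 j) - x ord0)
      = (i == j)%:R.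
    by rewrite Gx (inj_eq lift_inj) [lift ord0 i == ord0]eq_sym (negbTE (neq_lift _ _)) subr0.
  have sd (i : 'I_4) : \sum_k ((k == i)%:R : R) = 1.
    by rewrite (bigD1 i)//= eqxx big1 ?addr0// => k /negbTE ->.
  have sx (i : 'I_4) : \sum_k ((k == i)%:R : R) *: x k = x i.
    rewrite (bigD1 i)//= eqxx big1 ?addr0 ?scale1r// => k /negbTE ->.
    by rewrite scale0r.
  have g0 j : \sum_k dotv (G k) (x (lift ord0 j) - x ord0) = 0.
    by under eq_bigr do rewrite Gx; rewrite sumrB !sd subrr.
  have gx j : \sum_k dotv (G k) (x (lift ord0 j) - x ord0) *: x k
      = x (lift ord0 j) - x ord0.
    by under eq_bigr do rewrite Gx scalerBl; rewrite sumrB !sx.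
  have := sum_enorm_gt (fun k => (hx k).1) hb g0 gx.
  apply/negP; rewrite -leNgt.
  have -> : \sum_k enorm (G k) = rho^-1 * \sum_k enorm (g k).
    rewrite mulr_sumr; apply: eq_bigr => k _.
    by rewrite enormZ enorm_frame// gtr0_norm// invr_gt0.
  apply: (@le_trans _ _ (D^-1 * (437 / 125))).
    apply: ler_pM => //; first by rewrite invr_ge0.
      by apply: sumr_ge0 => k _; exact: enorm_ge0.
    by rewrite lef_pV2.
  by rewrite mulrC ler_pM2r ?invr_gt0//; lra.
right; exists (fun j => x (lift i j)), (fun j => rho *: y j), nu, (rho ^+ 2 * Y).
split=> //.
- split; first by move=> j; case: (hx (lift i j)).
  by rewrite [_ * D ^+ 2]mulrC; apply: ler_pM => //; exact: sqr_ge0.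
- by move=> j; rewrite !dotv_lin yy mulrA.
- by move=> j k; rewrite -scalerBr yw wp.
- under eq_bigr do rewrite scalerA mulrC -scalerA.
  by rewrite -scaler_sumr nuy scaler0.
Qed.

(** [45/64 = 3/4 * 15/16]: in the triangle case two vertices have inner product at most [- Y / 2],
    so half their difference has squared norm at least [3/4 * Y]. *)
Lemma exists_long_chord (E : 'M[R]_(3, 5)) : E *m E^T = 1%:M ->
  exists2 z, half_chord K z &
    45 / 64 * D ^+ 2 <= dotv (z *m E^T) (z *m E^T).
Proof.
move=> EE; have [[z Kz hz]|] := frame_cases EE.
  by exists z => //; apply: le_trans hz; rewrite ler_wpM2r ?sqr_ge0//; lra.
move=> [x [y [nu [Y [[Kx Y1] yy yx [nu0 nu1] nuy]]]]].
have Yp : 0 < Y by apply: lt_le_trans Y1; rewrite mulr_gt0 ?exprn_gt0//; lra.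
have [i [j ij]] := circ_far_pair Yp yy nu0 nu1 nuy.
exists (2^-1 *: (x i - x j)); first by exists (x i, x j); [split; exact: Kx|].
rewrite -scalemxAl -yx !dotv_lin !yy (dotvC (y j)); lra.
Qed.

(** Three half-chords, each long in a frame orthogonal to those chosen before, span a positive
    volume. *)
Lemma maximal_gram3_gt0 (z1 z2 z3 : 'rV[R]_5) :
  (forall a b c, half_chord K a -> half_chord K b ->
     half_chord K c -> gram3 a b c <= gram3 z1 z2 z3) ->
  0 < gram3 z1 z2 z3.
Proof.
move=> hm.
have lp : 0 < 45 / 64 * D ^+ 2 by rewrite mulr_gt0 ?exprn_gt0//; lra.
have [E [EE _ _]] := exists_frame (0 : 'rV[R]_5) 0.
have [c hc] := exists_long_chord EE; move/(lt_le_trans lp) => c1.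
have cp : 0 < dotv c c by apply: lt_le_trans (bessel EE c).
have [E' [EE' cE _]] := exists_frame c c.
have [b hb] := exists_long_chord EE'; move/(lt_le_trans lp) => b1.
have bp : 0 < gram2 b c.
  by apply: lt_le_trans (gram2_frame b EE' cE); rewrite mulr_gt0.
have [E2 [EE2 bE2 cE2]] := exists_frame b c.
have [a ha] := exists_long_chord EE2; move/(lt_le_trans lp) => a1.
apply: lt_le_trans (hm a b c ha hb hc).
by apply: lt_le_trans (gram3_frame a EE2 bE2 cE2 bp); rewrite mulr_gt0.
Qed.

End Ratio.

(** * Inscribed balls *)

Section Dual.
Variables (R : realType) (n : nat).
Implicit Types u v z a b : 'rV[R]_n.

(** The element of the dual basis of [z], [a], [b] that belongs to [z]; its norm is the inverse of
    the height of [z]. *)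
Definition dual3 z a b : 'rV[R]_n := (gram3 z a b)^-1 *: normal3 z a b.

Lemma dual3_fst z a b : 0 < gram3 z a b -> dotv (dual3 z a b) z = 1.
Proof. by move=> g0; rewrite dotvZl normal3_fst mulVf// gt_eqF. Qed.

Lemma dual3_snd z a b : dotv (dual3 z a b) a = 0.
Proof. by rewrite dotvZl normal3_snd mulr0. Qed.

Lemma dual3_thd z a b : dotv (dual3 z a b) b = 0.
Proof. by rewrite dotvZl normal3_thd mulr0. Qed.

Lemma dual3_sqr z a b : 0 < gram3 z a b ->
  dotv (dual3 z a b) (dual3 z a b) = gram2 a b / gram3 z a b.
Proof.
move=> g0; have gn : gram3 z a b != 0 by rewrite gt_eqF.
by rewrite /dual3 dotvZl dotvZr normal3_sqr; field.
Qed.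

Definition dual2 u v : 'rV[R]_n :=
  (gram2 u v)^-1 *: (dotv v v *: u - dotv u v *: v).

Lemma dual2_fst u v : 0 < gram2 u v -> dotv (dual2 u v) u = 1.
Proof.
move=> g0; have gn : gram2 u v != 0 by rewrite gt_eqF.
rewrite /dual2 !dotv_lin (dotvC v u).
by apply: (mulfI gn); rewrite mulVKf// /gram2; ring.
Qed.

Lemma dual2_snd u v : dotv (dual2 u v) v = 0.
Proof. by rewrite /dual2 !dotv_lin; ring. Qed.

Lemma dual2_sqr u v : 0 < gram2 u v ->
  dotv (dual2 u v) (dual2 u v) * gram2 u v = dotv v v.
Proof.
move=> g0; have gn : gram2 u v != 0 by rewrite gt_eqF.
rewrite {2}/dual2 !dotvZr dotvDr dotvNr !dotvZr dual2_fst// dual2_snd.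
by field.
Qed.

Lemma dual2_dot u v : 0 < gram2 u v ->
  dotv (dual2 u v) (dual2 v u) * gram2 u v = - dotv u v.
Proof.
move=> g0; have gn : gram2 u v != 0 by rewrite gt_eqF.
rewrite {2}/dual2 !dotvZr dotvDr dotvNr !dotvZr dual2_fst// dual2_snd (gram2C v u).
by rewrite (dotvC v u); field.
Qed.

Lemma gram2_le u v s : dotv v v <= s -> gram2 u v <= s * dotv u u.
Proof.
move=> vs; rewrite /gram2 lerBlDr [dotv u u * _]mulrC.
by apply: ler_wpDr; [exact: sqr_ge0|rewrite ler_wpM2r ?dotv_ge0].
Qed.

Lemma enorm_mul_le a t m : 0 <= t -> 0 <= m -> dotv a a * t <= m ^+ 2 ->
  enorm a * Num.sqrt t <= m.
Proof.
move=> t0 m0 h; rewrite -ler_sqr ?nnegrE ?mulr_ge0 ?enorm_ge0 ?sqrtr_ge0//.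
by rewrite exprMn enorm_sqr sqr_sqrtr.
Qed.

(** The left side is the geometric mean of [l] and [s]. *)
Lemma enorm_mul_le_mean a g s l : 0 <= g -> 0 <= s ->
  dotv a a * g = l -> 0 <= l -> enorm a * Num.sqrt (g * s) <= (l + s) / 2.
Proof.
move=> g0 s0 al l0; apply: enorm_mul_le; first exact: mulr_ge0.
  by lra.
by rewrite mulrA al; have := sqr_ge0 (l - s); lra.
Qed.

(** [407/200] lies just above the square root of [2048/495]. *)
Lemma enorm_mul_le_extent a (g s d b : R) : 0 <= g -> 0 <= s -> 0 < d ->
  dotv a a * d ^+ 2 = b -> g * b <= 2048 / 495 * d ^+ 2 * s ->
  enorm a * Num.sqrt (g * s) <= 407 / 200 * s.
Proof.
move=> g0 s0 d0 ab h; apply: enorm_mul_le; first exact: mulr_ge0.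
  by lra.
have d2 : 0 < d ^+ 2 by rewrite exprn_gt0.
rewrite -(ler_pM2r d2) mulrAC ab.
have h1 := ler_wpM2r s0 h.
have h2 : 0 <= d ^+ 2 * s ^+ 2 by rewrite mulr_ge0 ?sqr_ge0.
by lra.
Qed.

End Dual.

(** [s] is chosen so that [11/32 * s = D ^+ 2], which turns [final_ratio] into a bound on
    [S * D]. *)
Lemma sum_le_ratio (R : realType) (D g X S : R) (s := 32 / 11 * D ^+ 2) :
  0 < D -> 0 <= X -> X <= 17 / 165 * s -> (3 * s + X) * (s - X) <= 4 * g ->
  0 <= S -> 0 <= g -> S * Num.sqrt (g * s) <= 1007 / 200 * s - X / 2 ->
  S <= 197 / 56 / D.
Proof.
move=> Dp X0 Xs gX S0 g0 h.
have sp : 0 < s by rewrite mulr_gt0 ?exprn_gt0//; lra.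
have t0 : 0 <= g * s by rewrite mulr_ge0// ltW.
have m0 : 0 <= S * Num.sqrt (g * s) by rewrite mulr_ge0 ?sqrtr_ge0.
have SD : S ^+ 2 * (11 / 32 * s) <= (197 / 56) ^+ 2.
  apply: (final_ratio sp X0 Xs gX S0).
  have -> : S ^+ 2 * g * s = (S * Num.sqrt (g * s)) ^+ 2.
    by rewrite exprMn (sqr_sqrtr t0) [RHS]mulrA.
  rewrite -subr_ge0 subr_sqr; apply: mulr_ge0; first by rewrite subr_ge0.
  by apply: addr_ge0; [exact: le_trans h|].
have r0 : 0 <= 197 / 56 :> R by lra.
have DS : 0 <= S * D by rewrite mulr_ge0// ltW.
rewrite ler_pdivlMr// -ler_sqr; [|exact: DS|exact: r0].
by rewrite exprMn; apply: le_trans SD; rewrite /s; lra.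
Qed.

(** * The octahedron, and the triangle with a chord *)

Section Contradiction.
Variables (R : realType) (K : set 'rV[R]_5).
Hypotheses (cK : compact K) (vK : convex_set K) (K0 : K !=set0).
Let D := outer_radius 3 K.
Hypothesis Dp : 0 < D.
Hypothesis rD : inner_radius 3 K < D / (197 / 56).

(** The octahedron case: each end of chord [j] carries the functional [h j] with factor [1/2] or
    [-1/2], so the norms sum to that of the three [h j]. *)
Lemma small_duals_absurd (z h : 'I_3 -> 'rV[R]_5) :
  (forall j, half_chord K (z j)) ->
  (forall i j, dotv (h i) (z j) = (i == j)%:R) ->
  (forall i, 8 / 11 * D ^+ 2 * dotv (h i) (h i) <= 1) -> False.
Proof.
move=> Kz hz hs.
have /choice[pq hpq] : forall j, exists pq : 'rV[R]_5 * 'rV[R]_5,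
    [/\ K pq.1, K pq.2 & z j = 2^-1 *: (pq.1 - pq.2)].
  by move=> j; have [[p q] [/= Kp Kq] <-] := Kz j; exists (p, q).
pose x (k : 'I_3 * bool) := if k.2 then (pq k.1).1 else (pq k.1).2.
pose g (k : 'I_3 * bool) : 'rV[R]_5 := (if k.2 then 2^-1 else - 2^-1) *: h k.1.
have Kx k : K (x k) by rewrite /x; have [Kp Kq _] := hpq k.1; case: k.2.
have sp (V : nmodType) (F : 'I_3 * bool -> V) :
    \sum_k F k = \sum_i (F (i, true) + F (i, false)).
  rewrite (eq_bigr (fun k => F (k.1, k.2))); last by case.
  by rewrite -(pair_bigA _ (fun i e => F (i, e)))/=; under eq_bigr do
    rewrite big_bool.
have g0 j : \sum_k dotv (g k) (z j) = 0.
  by rewrite sp big1// => i _; rewrite /g/= !dotvZl; ring.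
have gx j : \sum_k dotv (g k) (z j) *: x k = z j.
  rewrite sp (bigD1 j)//= big1; last first.
    by move=> i /negbTE ij; rewrite /g/= !dotvZl hz ij !mulr0 !scale0r addr0.
  rewrite /g /x/= !dotvZl hz eqxx !mulr1 addr0 scaleNr -scalerBr.
  by have [_ _ ->] := hpq j.
have := sum_enorm_gt cK vK rD Kx hz g0 gx; apply/negP; rewrite -leNgt sp.
(* [197/168] lies just above the square root of [11/8], and three times it is [197/56]. *)
have hh i : enorm (g (i, true)) + enorm (g (i, false)) <= 197 / 168 / D.
  rewrite /g/= !enormZ normrN gtr0_norm; last by rewrite invr_gt0.
  rewrite -mulrDl -div1r -splitr mul1r enorm_le; last first.
    by apply: divr_ge0; [lra|exact: ltW].
  rewrite exprMn exprVn ler_pdivlMr ?exprn_gt0//; have := hs i; nra.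
apply: le_trans (ler_sum _ (fun i _ => hh i)) _.
by rewrite sumr_const card_ord -[_ *+ 3]mulr_natl mulrA ler_pM2r ?invr_gt0//; lra.
Qed.

Section TriangleBall.
Variables (x : 'I_3 -> 'rV[R]_5) (y : 'I_3 -> 'rV[R]_3) (nu : 'I_3 -> R) (Y : R).
Variables (E : 'M[R]_(3, 5)) (u0 p q z : 'rV[R]_5) (d : R).
Hypotheses (Kx : forall j, K (x j)) (Y1 : 15 / 16 * D ^+ 2 <= Y).
Hypotheses (yy : forall j, dotv (y j) (y j) = Y).
Hypotheses (yx : forall j k, y j - y k = (x j - x k) *m E^T).
Hypotheses (nu0 : forall j, 0 <= nu j) (nu1 : \sum_j nu j = 1).
Hypotheses (nuy : \sum_j nu j *: y j = 0).
Hypotheses (EE : E *m E^T = 1%:M) (u01 : dotv u0 u0 = 1) (u0E : u0 *m E^T = 0).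
Hypotheses (Kp : K p) (Kq : K q) (zpq : z = 2^-1 *: (p - q))
  (zE : z *m E^T = 0).
Hypotheses (d0 : 0 < d) (u0d : dotv u0 z = d).
Hypotheses (side_le : forall j k,
  dotv (y j - y k) (y j - y k) <= 32 / 11 * D ^+ 2).
Hypotheses (ext_le : forall j k, dotv (y j - y k) (y j - y k)
  + dotv u0 (x j - x k) ^+ 2 <= 2048 / 495 * d ^+ 2).

(** The 3-space is spanned by two sides [a], [b] of the triangle and the half-chord [z]. The
    triangle vertices carry the gradients of their barycentric coordinates, pulled back by [E]; the
    ends of the chord carry half of [m] and of [- m], where [m] vanishes on [a] and [b]. *)
Lemma triangle_ball_absurd : False.
Proof.
have num : 165 / 512 * (32 / 11) <= 15 / 16 :> R by lra.
pose s := 32 / 11 * D ^+ 2.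
have sp : 0 < s by rewrite mulr_gt0 ?exprn_gt0//.
have Yp : 0 < Y by apply: lt_le_trans Y1; rewrite mulr_gt0 ?exprn_gt0//; lra.
have [sides prod] := circ_sides Yp yy nu0 nu1 nuy.
pose i0 : 'I_3 := ord0; pose i1 : 'I_3 := lift ord0 ord0.
pose i2 : 'I_3 := lift ord0 (lift ord0 ord0).
set u := y i0 - y i2 in sides prod; set v := y i1 - y i2 in sides prod.
have uv : u - v = y i0 - y i1 by rewrite /u /v opprB addrA subrK.
have us : dotv u u <= s := side_le _ _.
have vs : dotv v v <= s := side_le _ _.
have ws : dotv (u - v) (u - v) <= s by rewrite uv.
pose a := x i0 - x i2; pose b := x i1 - x i2.
have aE : a *m E^T = u by rewrite /a -yx.
have bE : b *m E^T = v by rewrite /b -yx.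
pose P := dotv u0 a; pose Q := dotv u0 b.
have eu : dotv u u + P ^+ 2 <= 2048 / 495 * d ^+ 2 := ext_le i0 i2.
have ev : dotv v v + Q ^+ 2 <= 2048 / 495 * d ^+ 2 := ext_le i1 i2.
have ew : dotv (u - v) (u - v) + (P - Q) ^+ 2 <= 2048 / 495 * d ^+ 2.
  have -> : P - Q = dotv u0 (x i0 - x i1).
    by rewrite /P /Q /a /b !dotv_lin; ring.
  by rewrite uv.
clearbody u v.
have u_ge := dotv_ge0 u; have v_ge := dotv_ge0 v; have w_ge := dotv_ge0 (u - v).
(* The total defect of the squared sides from their upper bound [s]. *)
pose X := 3 * s - (dotv v v + dotv u u + dotv (u - v) (u - v)).
have wE : dotv (u - v) (u - v) = dotv u u + dotv v v - 2 * dotv u v.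
  by rewrite !dotv_lin (dotvC v u); ring.
have [X0 Xs gX gp4] : [/\ 0 <= X, X <= 17 / 165 * s,
    (3 * s + X) * (s - X) <= 4 * gram2 u v & 0 < 4 * gram2 u v].
  apply: (acute_triangle_bounds sp _ _ _ _ sides _ prod (erefl X)).
  - by rewrite v_ge.
  - by rewrite u_ge.
  - by rewrite w_ge.
  - by apply: le_trans Y1; rewrite /s mulrA ler_pM2r ?exprn_gt0.
  - by rewrite wE /gram2; ring.
have gp : 0 < gram2 u v by move: gp4; rewrite pmulr_rgt0.
have gp' : 0 < gram2 v u by rewrite gram2C.
have gn : gram2 u v != 0 by rewrite gt_eqF.
pose U := dual2 u v; pose V := dual2 v u.
have Uu : dotv U u = 1 := dual2_fst gp.
have Uv : dotv U v = 0 := dual2_snd _ _.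
have Vv : dotv V v = 1 := dual2_fst gp'.
have Vu : dotv V u = 0 := dual2_snd _ _.
have UU : dotv U U * gram2 u v = dotv v v := dual2_sqr gp.
have VV : dotv V V * gram2 u v = dotv u u by rewrite gram2C; exact: dual2_sqr.
have UV : dotv U V * gram2 u v = - dotv u v := dual2_dot gp.
clearbody U V.
(* The gradient, in the plane of the triangle, of its tilt in direction [u0]; subtracting it from
   [u0] makes [m] vanish on [a] and [b]. *)
pose be := P *: U + Q *: V.
have be2 : dotv be be * gram2 u v =
    P ^+ 2 * dotv v v + Q ^+ 2 * dotv u u - 2 * P * Q * dotv u v.
  rewrite /be !dotv_lin (dotvC V U) -UU -VV.
  by apply/eqP; rewrite -subr_eq0; apply/eqP; rewrite -[dotv u v]opprK -UV; ring.
have bu : dotv be u = P by rewrite /be !dotv_lin Uu Vu; ring.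
have bv : dotv be v = Q by rewrite /be !dotv_lin Uv Vv; ring.
clearbody be.
have dn : d != 0 by rewrite gt_eqF.
pose m : 'rV[R]_5 := d^-1 *: (u0 - be *m E).
have mE w : dotv (w *m E) u0 = 0.
  by rewrite dotvC -dotv_mulmx_tr u0E dotv0l.
have Em w c : dotv (w *m E) c = dotv w (c *m E^T).
  by rewrite dotvC -dotv_mulmx_tr dotvC.
have mm : dotv m m * d ^+ 2 = 1 + dotv be be.
  by rewrite /m !dotv_lin (dotvC u0) mE u01 dotv_frame//; field.
have ma : dotv m a = 0.
  by rewrite /m dotvZl dotvDl dotvNl Em aE bu subrr mulr0.
have mb : dotv m b = 0.
  by rewrite /m dotvZl dotvDl dotvNl Em bE bv subrr mulr0.
have mz : dotv m z = 1.
  by rewrite /m dotvZl dotvDl dotvNl Em zE dotv0r u0d subr0 mulVf.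
clearbody m.
(* [extent_cases] selects a side whose tilt controls [be]; the same side bounds [gram2 u v], so its
   extent hypothesis bounds the sum. *)
have ext : gram2 u v * (1 + dotv be be) <= 2048 / 495 * d ^+ 2 * s.
  have gu : gram2 u v <= s * dotv u u by exact: gram2_le.
  have gv : gram2 u v <= s * dotv v v by rewrite gram2C; exact: gram2_le.
  have gw : gram2 u v <= s * dotv (u - v) (u - v).
    have -> : gram2 u v = gram2 (u - v) v.
      by rewrite /gram2 wE !dotv_lin; ring.
    exact: gram2_le.
  have fin l e : gram2 u v <= s * l -> dotv be be * gram2 u v <= s * e ->
      l + e <= 2048 / 495 * d ^+ 2 ->
      gram2 u v * (1 + dotv be be) <= 2048 / 495 * d ^+ 2 * s.
    move=> h1 h2 h3; rewrite mulrDr mulr1 [_ * dotv be be]mulrC.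
    by apply: le_trans (lerD h1 h2) _; rewrite -mulrDr mulrC ler_pM2r.
  rewrite wE in ws w_ge gw ew.
  have [] := @extent_cases _ P Q _ _ _ _ u_ge v_ge us vs ws w_ge;
    rewrite -be2 => he.
  - exact: fin gu he eu.
  - exact: fin gv he ev.
  - exact: fin gw he ew.
pose bb (j : 'I_3) := nth 0 [:: a; b; z] j.
pose hh (j : 'I_3) := nth 0 [:: U *m E; V *m E; m] j.
pose gl (j : 'I_3) := nth 0 [:: U *m E; V *m E; - (U + V) *m E] j.
pose xx (k : 'I_3 + bool) :=
  match k with inl j => x j | inr e => if e then p else q end.
pose g (k : 'I_3 + bool) :=
  match k with inl j => gl j | inr e => (if e then 2^-1 else - 2^-1) *: m end.
have Kxx k : K (xx k) by case: k => [j|[]] /=.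
have sumk (W : nmodType) (F : 'I_3 + bool -> W) : \sum_k F k =
    F (inl i0) + F (inl i1) + F (inl i2) + (F (inr true) + F (inr false)).
  by rewrite big_sumType/= !big_ord_recl big_ord0 addr0 big_bool addrA.
have hb i j : dotv (hh i) (bb j) = (i == j)%:R.
  case: i => [[|[|[|//]]] ip]; case: j => [[|[|[|//]]] jp];
    by rewrite /hh /bb/= ?Em ?aE ?bE ?zE ?dotv0r.
have gE j : [/\ dotv (g (inl i0)) (bb j) = dotv U (bb j *m E^T),
    dotv (g (inl i1)) (bb j) = dotv V (bb j *m E^T) &
    dotv (g (inl i2)) (bb j) = - dotv U (bb j *m E^T) - dotv V (bb j *m E^T)].
  by rewrite /g /gl/= !Em !dotv_lin opprD.
have g0 j : \sum_k dotv (g k) (bb j) = 0.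
  by rewrite sumk; have [-> -> ->] := gE j; rewrite /= !dotvZl; ring.
have gx j : \sum_k dotv (g k) (bb j) *: xx k = bb j.
  rewrite sumk; have [-> -> ->] := gE j; rewrite /= !dotvZl.
  case: j => [[|[|[|//]]] jp]; rewrite /bb/= ?aE ?bE ?zE ?Uu ?Uv ?Vu ?Vv.
  - by rewrite ma subr0 !mulr0 !scale0r scaleN1r scale1r !addr0.
  - by rewrite mb oppr0 sub0r !mulr0 !scale0r scaleN1r scale1r !addr0 add0r.
  - rewrite mz !dotv0r oppr0 addr0 !scale0r !mulr1 !add0r.
    by rewrite scaleNr -scalerBr -zpq.
have := sum_enorm_gt cK vK rD Kxx hb g0 gx. apply/negP; rewrite -leNgt.
have -> : \sum_k enorm (g k) = enorm U + enorm V + enorm (U + V) + enorm m.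
  rewrite sumk/= /gl/= !enorm_frame// enormN !enormZ normrN.
  by rewrite gtr0_norm ?invr_gt0// -mulrDl -div1r -splitr mul1r.
set S := _ + _.
have S0 : 0 <= S by rewrite /S !addr_ge0 ?enorm_ge0.
pose t := gram2 u v * s.
have t0 : 0 <= t by rewrite mulr_ge0// ltW.
have amgm (c : 'rV[R]_3) l : dotv c c * gram2 u v = l -> 0 <= l ->
    enorm c * Num.sqrt t <= (l + s) / 2.
  by apply: enorm_mul_le_mean; exact: ltW.
have hU := amgm _ _ UU v_ge; have hV := amgm _ _ VV u_ge.
have hW : enorm (U + V) * Num.sqrt t <= (dotv (u - v) (u - v) + s) / 2.
  apply: amgm => //; rewrite wE !dotv_lin (dotvC V U) !mulrDl UU VV UV.
  by ring.
have hm := enorm_mul_le_extent (ltW gp) (ltW sp) d0 mm ext.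
apply: (sum_le_ratio Dp X0 Xs gX S0 (ltW gp)).
have eS T : S * T = enorm U * T + enorm V * T + enorm (U + V) * T + enorm m * T.
  by rewrite /S; ring.
have eX : (dotv v v + s) / 2 + (dotv u u + s) / 2
    + (dotv (u - v) (u - v) + s) / 2 + 407 / 200 * s = 1007 / 200 * s - X / 2.
  by rewrite /X; field.
by have := lerD (lerD (lerD hU hV) hW) hm; rewrite eX -eS.
Qed.

End TriangleBall.
End Contradiction.

(** * Half-chords of maximal volume *)

Section Maximal.
Variables (R : realType) (K : set 'rV[R]_5).
Hypotheses (cK : compact K) (vK : convex_set K) (K0 : K !=set0).
Let D := outer_radius 3 K.
Hypothesis Dp : 0 < D.
Hypothesis rD : inner_radius 3 K < D / (197 / 56).

Section SmallHeight.
Variables z1 z2 z3 : 'rV[R]_5.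
Hypothesis Kz2 : half_chord K z2.
Hypothesis Kz3 : half_chord K z3.
Hypothesis hm : forall a b c, half_chord K a -> half_chord K b ->
  half_chord K c -> gram3 a b c <= gram3 z1 z2 z3.
Hypothesis gp : 0 < gram3 z1 z2 z3.
Hypothesis small : gram3 z1 z2 z3 < 8 / 11 * D ^+ 2 * gram2 z2 z3.

Lemma gram2_small_height : 0 < gram2 z2 z3.
Proof.
rewrite lt0r gram2_ge0 andbT; apply/eqP => g0.
by move: small; rewrite g0 mulr0 ltNge ltW.
Qed.

(* [512/495 = (8/11) / (45/64)]. *)
Lemma area_le z : half_chord K z ->
  gram2 z z3 <= 512 / 495 * gram2 z2 z3.
Proof.
move=> Kz; have G0 := gram2_small_height.
have [g0|g0] := leP (gram2 z z3) 0.
  by apply: le_trans g0 _; apply: mulr_ge0; [lra|exact: ltW].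
have [E [EE zE z3E]] := exists_frame z z3.
(* A half-chord long across [z] and [z3] would, if the area of [z] and [z3] were too large, span
   more than the maximal volume. *)
have [w Kw hw] := exists_long_chord cK vK K0 Dp rD EE.
have h1 := gram3_frame w EE zE z3E g0.
have h2 := hm Kw Kz Kz3.
have h3 := ler_wpM2r (ltW g0) hw.
have D2 : 0 < D ^+ 2 by rewrite exprn_gt0.
have h4 : 45 / 64 * D ^+ 2 * gram2 z z3 <= 8 / 11 * D ^+ 2 * gram2 z2 z3.
  exact: le_trans (le_trans (le_trans h3 h1) h2) (ltW small).
by rewrite -(ler_pM2l D2); lra.
Qed.

(** Project along the plane of [z2] and [z3]: maximality makes all half-chords shorter than the
    far-pair bound there, so [frame_cases] leaves only the triangle, which is combined with the
    chord of [z2]. *)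
Lemma small_height_absurd : False.
Proof.
have G0 := gram2_small_height.
have z3p : 0 < dotv z3 z3.
  rewrite lt0r dotv_ge0 andbT dotv_eq0; apply/eqP => z30.
  by move: G0; rewrite z30 /gram2 !dotv0r mulr0 expr0n subr0 ltxx.
have z3n : dotv z3 z3 != 0 by rewrite gt_eqF.
(* The component orthogonal to [z3]; [u0] is the direction of [pr z2] and [d] its length. *)
pose pr (z : 'rV[R]_5) := z - dotv z z3 / dotv z3 z3 *: z3.
have pr3 z : dotv (pr z) z3 = 0 by rewrite /pr !dotv_lin; field.
have prz z c : dotv (pr z) (pr c) = dotv (pr z) c.
  by rewrite {2}/pr dotvDr dotvNr dotvZr pr3 mulr0 subr0.
have prE z : dotv (pr z) (pr z) = gram2 z z3 / dotv z3 z3.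
  by rewrite prz /pr !dotv_lin (dotvC z3 z) /gram2; field.
pose d := enorm (pr z2).
have dd : d ^+ 2 = gram2 z2 z3 / dotv z3 z3 by rewrite enorm_sqr prE.
have dp : 0 < d.
  rewrite lt0r enorm_ge0 andbT; apply/eqP => d0.
  by move: dd; rewrite d0 expr0n => /esym/eqP; rewrite gt_eqF// divr_gt0.
have dn : d != 0 by rewrite gt_eqF.
pose u0 := d^-1 *: pr z2.
have u01 : dotv u0 u0 = 1.
  by rewrite /u0 dotvZl dotvZr prE -dd; field.
have u03 : dotv u0 z3 = 0 by rewrite /u0 dotvZl pr3 mulr0.
have u02 : dotv u0 z2 = d.
  by rewrite /u0 dotvZl -prz prE -dd; field.
have [E [EE z2E z3E]] := exists_frame z2 z3.
have prEE z : pr z *m E^T = z *m E^T.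
  by rewrite /pr mulmxBl -scalemxAl z3E scaler0 subr0.
have u0E : u0 *m E^T = 0 by rewrite /u0 -scalemxAl prEE z2E scaler0.
have u0pr z : dotv u0 (pr z) = dotv u0 z.
  by rewrite /u0 !dotvZl prz.
have low z : half_chord K z ->
    dotv (z *m E^T) (z *m E^T) < 8 / 11 * D ^+ 2.
  move=> Kz; rewrite -(ltr_pM2r G0).
  apply: le_lt_trans small; apply: le_trans (hm Kz Kz2 Kz3).
  exact: gram3_frame.
(* [bessel_unit] bounds the left side by the squared norm of [pr z]; dividing [area_le] by
   [dotv z3 z3] bounds that. *)
have ext z : half_chord K z ->
    dotv (z *m E^T) (z *m E^T) + dotv u0 z ^+ 2 <= 512 / 495 * d ^+ 2.
  move=> Kz; have := bessel_unit EE (pr z) u01 u0E.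
  rewrite prEE (dotvC _ u0) u0pr prE => /le_trans; apply.
  by rewrite dd mulrA ler_pM2r ?invr_gt0// area_le.
have [[z Kz]|] := frame_cases cK vK K0 Dp rD EE.
  by rewrite leNgt low.
move=> [x [y [nu [Y [[Kx Y1] yy yx [nu0 nu1] nuy]]]]].
have [[p q] [/= Kp Kq] zpq] := Kz2.
have Kxx j k : half_chord K (2^-1 *: (x j - x k)).
  by exists (x j, x k) => //; split; exact: Kx.
have xy j k : (2^-1 *: (x j - x k)) *m E^T = 2^-1 *: (y j - y k).
  by rewrite -scalemxAl yx.
apply: (@triangle_ball_absurd _ _ cK vK Dp rD x y nu Y E u0 p q z2 d) => //.
- move=> j k; have := low _ (Kxx j k); rewrite xy dotvZl dotvZr; lra.
- move=> j k; have := ext _ (Kxx j k); rewrite xy !(dotvZl, dotvZr); lra.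
Qed.

End SmallHeight.

(** By cyclic symmetry of the volume, each of the three heights may play the small one; if none is
    small, the dual vectors are short enough for the octahedron. *)
Lemma radii_contradiction : False.
Proof.
have [z1 [z2 [z3 [Kz1 Kz2 Kz3 hm]]]] := maximal_gram3 cK K0.
have gp := maximal_gram3_gt0 cK vK K0 Dp rD hm.
have r1 : gram3 z2 z3 z1 = gram3 z1 z2 z3 by rewrite (gram3_rot z1).
have r2 : gram3 z3 z1 z2 = gram3 z1 z2 z3 by rewrite (gram3_rot z3).
have h1 : 8 / 11 * D ^+ 2 * gram2 z2 z3 <= gram3 z1 z2 z3.
  by rewrite leNgt; apply/negP => lt; apply: (small_height_absurd Kz2 Kz3 hm gp lt).
have h2 : 8 / 11 * D ^+ 2 * gram2 z3 z1 <= gram3 z2 z3 z1.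
  rewrite leNgt; apply/negP => lt.
  by apply: (small_height_absurd Kz3 Kz1 _ _ lt); rewrite r1.
have h3 : 8 / 11 * D ^+ 2 * gram2 z1 z2 <= gram3 z3 z1 z2.
  rewrite leNgt; apply/negP => lt.
  by apply: (small_height_absurd Kz1 Kz2 _ _ lt); rewrite r2.
have gp1 : 0 < gram3 z2 z3 z1 by rewrite r1.
have gp2 : 0 < gram3 z3 z1 z2 by rewrite r2.
have dle (a b c : 'rV[R]_5) : 0 < gram3 a b c ->
    8 / 11 * D ^+ 2 * gram2 b c <= gram3 a b c ->
    8 / 11 * D ^+ 2 * dotv (dual3 a b c) (dual3 a b c) <= 1.
  by move=> g0 h; rewrite dual3_sqr// mulrA ler_pdivrMr// mul1r.
pose z (j : 'I_3) := nth 0 [:: z1; z2; z3] j.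
pose h (j : 'I_3) :=
  nth 0 [:: dual3 z1 z2 z3; dual3 z2 z3 z1; dual3 z3 z1 z2] j.
apply: (@small_duals_absurd _ _ cK vK Dp rD z h).
- by case=> [[|[|[|//]]] jp].
- move=> [[|[|[|//]]] ip] [[|[|[|//]]] jp]; rewrite /h /z/=;
    by rewrite ?dual3_fst ?dual3_snd ?dual3_thd.
- by case=> [[|[|[|//]]] jp]; rewrite /h/=; exact: dle.
Qed.

End Maximal.

(** * Nonnegativity of the outer radius and the bound on the ratio *)

Lemma inf_ge0 (R : realType) (A : set R) : (forall x, A x -> 0 <= x) ->
  0 <= inf A.
Proof.
move=> A_ge0; have [->|/set0P A0] := eqVneq A set0; first by rewrite inf0.
exact: lb_le_inf.
Qed.

Lemma outer_radius_ge0 (R : realType) n j (K : set 'rV[R]_n) :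
  0 <= outer_radius j K.
Proof. by apply: inf_ge0 => _ [L _ <-]; apply: inf_ge0 => r []. Qed.

Theorem theorem1p2 (R : realType) (K : set 'rV[R]_5) (hK : convex_body K) :
  outer_radius 3 K / inner_radius 3 K < 3518%:R / 1000%:R.
Proof.
have [cK vK [k /interior_subset Kk]] := hK.
have K0 : K !=set0 by exists k.
have [Dp|] := ltP 0 (outer_radius 3 K); last first.
  move=> D0; have -> : outer_radius 3 K = 0.
    by apply/eqP; rewrite eq_le D0 outer_radius_ge0.
  by rewrite mul0r; apply: divr_gt0; rewrite ltr0n.
have c0 : 0 < 197 / 56 :> R by lra.
have rD : outer_radius 3 K / (197 / 56) <= inner_radius 3 K.
  by rewrite leNgt; apply/negP; exact: radii_contradiction.
have rp : 0 < inner_radius 3 K by apply: lt_le_trans rD; rewrite divr_gt0.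
(* [197/56] is about 3.51786. *)
apply: (@le_lt_trans _ _ (197 / 56)); last lra.
by rewrite ler_pdivrMr// mulrC -ler_pdivrMr.
Qed.
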